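(* For any $\vec\alpha=(\alpha_m)_{m\ge3}$ with $\alpha_m\in[0,1]$ for all $m\ge3$ and $\alpha_m\in\left[1-\frac1m,1\right]$ for sufficiently large $m$, there exists a polynomial-time algorithm for Semi-Random-DodgsonScore under $\vec\alpha$-IC that succeeds with probability at least $$1-2(m-1)\exp\left(-\frac{n}{72m^2}\right),$$ where $m$ is the number of alternatives and $n$ is the number of agents.
   Context: **Voting.** $\mathcal A_m=\{a_1,\dots,a_m\}$ is a set of $m$ alternatives ($m\ge 3$) and $\mathcal L(\mathcal A_m)$ is the set of rankings (linear orders) over $\mathcal A_m$. A profile $P\in\mathcal L(\mathcal A_m)^n$ is a collection of $n$ agents' rankings. **Dodgson score.** The Condorcet winner of a profile is the alternative that is preferred to every other alternative by strictly more than half of the agents. The Dodgson score of $a$ in $P$ is the smallest number of sequential exchanges of adjacent alternatives in rankings of $P$ that make $a$ the Condorcet winner. DodgsonScore: given $P\in\mathcal L(\mathcal A_m)^n$, $a\in\mathcal A_m$, $t\in\mathbb N$, decide whether the Dodgson score of $a$ in $P$ is at most $t$. **$\alpha$-Impartial Culture.** For $\alpha\in[0,1]$, $\alpha$-IC is the single-agent preference model $\mathcal M_m=(\Theta_m,\mathcal L(\mathcal A_m),\Pi_m)$ with $\Theta_m=\mathcal L(\mathcal A_m)$ and $\Pi_m=\{\pi_R:R\in\mathcal L(\mathcal A_m)\}$, where $\Pr_{R'\sim\pi_R}[R']=\frac{\alpha}{m!}+(1-\alpha)\mathbf 1[R'=R]$. For $\vec\alpha=(\alpha_m)_{m\ge3}$,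 $\vec\alpha$-IC is the sequence of models $\{\alpha_m\text{-IC}:m\ge3\}$. **Semi-random problem.** A semi-random profile $P$ drawn from $\mathcal M_m$ is generated as follows: an adversary chooses any $(\pi_1,\dots,\pi_n)\in\Pi_m^n$; then agent $j$'s ranking is drawn from $\pi_j$, independently for $j=1,\dots,n$. In Semi-Random-DodgsonScore, the algorithm is given $a\in\mathcal A_m$, $t\in\mathbb N$ and a semi-random profile $P$ drawn from $\mathcal M_m$, and must decide whether the Dodgson score of $a$ in $P$ is at most $t$. It may return ''Failure'', but whenever it returns YES or NO the answer must be correct. It ''succeeds with probability at least $p$'' if, for every choice of the adversary, every $a$ and every $t$, it returns the (correct) YES/NO answer with probability at least $p$. *)

(* Defs.v *)
From mathcomp Require Import all_boot all_order all_algebra fingroup perm.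
From mathcomp Require Import reals.

Set Implicit Arguments.
Unset Strict Implicit.
Unset Printing Implicit Defensive.

Import Order.TTheory GRing.Theory Num.Theory.

(* A ranking of the alternatives 'I_m lists them from best to worst: R i is the
   alternative in position i, position 0 being the top. *)
Definition ranking (m : nat) := {perm 'I_m}.

Definition prefers m (R : ranking m) (a b : 'I_m) : bool :=
  (R^-1%g a < R^-1%g b)%N.

Definition profile (m n : nat) := {ffun 'I_n -> ranking m}.

Definition condorcet_winner m n (P : profile m n) (a : 'I_m) : bool :=
  [forall b : 'I_m, (b != a) ==> (n < 2 * #|[set j | prefers (P j) a b]|)%N].

(* One agent exchanges the alternatives in two consecutive positions; composition
   in {perm _} is in diagrammatic order, (s * t)%g x = t (s x). *)
Definition adjacent_exchange m n : rel (profile m n) := fun P Q =>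
  [exists j : 'I_n, exists i : 'I_m, exists i' : 'I_m,
     (i' == i.+1 :> nat) &&
     (Q == [ffun k => if k == j then (tperm i i' * P k)%g else P k])].

Definition wins_after m n (P : profile m n) (a : 'I_m) (k : nat) : bool :=
  [exists s : k.-tuple (profile m n),
     path (@adjacent_exchange m n) P s && condorcet_winner (last P s) a].

Definition is_dodgson_score m n (P : profile m n) (a : 'I_m) (k : nat) : bool :=
  wins_after P a k && [forall l : 'I_k, ~~ wins_after P a l].

(* With no agents nobody can be made the Condorcet winner: there is no score, and
   the answer is false. *)
Definition dodgson_score_le m n (P : profile m n) (a : 'I_m) (t : nat) : bool :=
  [exists k : 'I_t.+1, is_dodgson_score P a k].

(* Random access machines with a read-only input, addition and truncated
   subtraction, programmed with while loops. Every instruction and every test has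
   unit cost; as there is no multiplication, a step lengthens the largest number
   in memory by at most one bit, so that polynomial time on these machines is
   polynomial time on Turing machines. *)
Inductive prog : Type :=
| Skip
| Const of nat & nat        (* mem[x] := c *)
| Add of nat & nat & nat    (* mem[x] := mem[y] + mem[z] *)
| Sub of nat & nat & nat    (* mem[x] := mem[y] - mem[z] *)
| Get of nat & nat          (* mem[x] := mem[mem[y]] *)
| Put of nat & nat          (* mem[mem[x]] := mem[y] *)
| Read of nat & nat         (* mem[x] := input[mem[y]] *)
| Seq of prog & prog
| If of nat & prog & prog   (* test mem[x] != 0 *)
| While of nat & prog.      (* loop as long as mem[x] != 0 *)

Definition memory := nat -> nat.

Definition upd (s : memory) (x v : nat) : memory :=
  fun y => if y == x then v else s y.

(* exec w c s s' k: on input w, started in memory s, the program c halts in memory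
   s' after k steps. Cells of the input beyond its end read as 0. *)
Inductive exec (w : seq nat) : prog -> memory -> memory -> nat -> Prop :=
| ExecSkip s : exec w Skip s s 1
| ExecConst s x c : exec w (Const x c) s (upd s x c) 1
| ExecAdd s x y z : exec w (Add x y z) s (upd s x (s y + s z)) 1
| ExecSub s x y z : exec w (Sub x y z) s (upd s x (s y - s z)) 1
| ExecGet s x y : exec w (Get x y) s (upd s x (s (s y))) 1
| ExecPut s x y : exec w (Put x y) s (upd s (s x) (s y)) 1
| ExecRead s x y : exec w (Read x y) s (upd s x (nth 0 w (s y))) 1
| ExecSeq c1 c2 s1 s2 s3 k1 k2 :
    exec w c1 s1 s2 k1 -> exec w c2 s2 s3 k2 ->
    exec w (Seq c1 c2) s1 s3 (k1 + k2)
| ExecIfT x c1 c2 s s' k :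
    s x != 0 -> exec w c1 s s' k -> exec w (If x c1 c2) s s' k.+1
| ExecIfF x c1 c2 s s' k :
    s x = 0 -> exec w c2 s s' k -> exec w (If x c1 c2) s s' k.+1
| ExecWhileT x c s1 s2 s3 k1 k2 :
    s1 x != 0 -> exec w c s1 s2 k1 -> exec w (While x c) s2 s3 k2 ->
    exec w (While x c) s1 s3 (k1 + k2).+1
| ExecWhileF x c s : s x = 0 -> exec w (While x c) s s 1.

(* The length of an input is the total number of bits of its entries, where 0 has
   one bit. *)
Definition input_size (w : seq nat) : nat :=
  \sum_(x <- w) (trunc_log 2 x).+1.

Definition encode m n (P : profile m n) (a : 'I_m) (t : nat) : seq nat :=
  [:: m, n, val a, t &
     flatten [seq [seq val (P j i) | i <- enum 'I_m] | j <- enum 'I_n]].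

(* Some true is YES, Some false is NO and None is "Failure". *)
Definition answer := option bool.

Definition encode_answer (o : answer) : nat :=
  if o is Some b then (if b then 1 else 2) else 0.

Definition algorithm :=
  forall m n : nat, profile m n -> 'I_m -> nat -> answer.

(* The output is the content of cell 0 of the memory, which is initially null. *)
Definition polynomial_time (A : algorithm) : Prop :=
  exists (c : prog) (K d : nat),
  forall (m n : nat) (P : profile m n) (a : 'I_m) (t : nat), (3 <= m)%N ->
  exists (s : memory) (k : nat),
    [/\ exec (encode P a t) c (fun=> 0) s k,
        s 0 = encode_answer (A m n P a t)
      & (k <= K * input_size (encode P a t) ^ d + K)%N].

Definition never_wrong (A : algorithm) : Prop :=
  forall (m n : nat) (P : profile m n) (a : 'I_m) (t : nat) (b : bool),
    (3 <= m)%N -> A m n P a t = Some b -> b = dodgson_score_le P a t.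

Local Open Scope ring_scope.

(* The distribution pi_R of the alpha-IC model. *)
Definition IC (R : realType) m (alpha : R) (r r' : ranking m) : R :=
  alpha / (m`!)%:R + (1 - alpha) * (r' == r)%:R.

(* Probability of E when agent j draws a ranking from pi j, independently. *)
Definition profile_prob (R : realType) m n (pi : 'I_n -> ranking m -> R)
    (E : pred (profile m n)) : R :=
  \sum_(P : profile m n | E P) \prod_(j < n) pi j (P j).

(* p m n is the success probability required with m alternatives and n agents;
   the adversary chooses the distribution pi_(theta j) for each agent j. *)
Definition succeeds_with_prob (R : realType) (alpha : nat -> R) (A : algorithm)
    (p : nat -> nat -> R) : Prop :=
  forall (m n : nat) (theta : 'I_n -> ranking m) (a : 'I_m) (t : nat),
    (3 <= m)%N ->
    p m n <= profile_prob (fun j => IC (alpha m) (theta j))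
               (fun P => A m n P a t == Some (dodgson_score_le P a t)).

(* Main.v *)
(* Call an agent good for a rival b when it prefers a to b or has b immediately
   above a. If for every rival more than half of the agents are good, then the
   lower bound on the score given by the sum of the numbers of agents missing for a
   to beat each rival is attained, by exchanging a with the alternative just above
   it in enough rankings; this answers the question greedily. Under IC an agent is
   good for b with probability at least alpha (1/2 + 1/m) >= 1/2 + 1/(6m), and a
   Chernoff bound together with a union bound over the rivals gives the success
   probability.

   Nothing bounds alpha_m for the finitely many m < m0, so there the answer must
   always be exact. An optimal sequence of exchanges only lifts a, to some position
   c_j in the ranking of each agent j, so that the question becomes a subset-sum
   problem with one group of choices per agent. The numbers of agents preferring a
   to each rival and the number of exchanges are the m digits of a number in radix
   2nm + 1, and dynamic programming over these numbers, of which there are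
   polynomially many for m < m0, decides it. *)

Require Import Defs.
From mathcomp Require Import all_boot all_order all_algebra fingroup perm.
From mathcomp Require Import reals sequences exp.
From mathcomp Require Import zify ring lra.

Set Implicit Arguments.
Unset Strict Implicit.
Unset Printing Implicit Defensive.

Import Order.TTheory GRing.Theory Num.Theory.
Local Notation Sub := Defs.Sub.

(** * Dodgson scores *)

Definition pos m n (P : profile m n) (j : 'I_n) (b : 'I_m) : nat :=
  ((P j)^-1)%g b.

(** When [a] is lifted to position [c j], it ends up above exactly the rivals whose old position is
    at least [c j]. This is thus the Condorcet condition after the lifts, read off the original
    profile. *)
Definition cut_wins m n (P : profile m n) (a : 'I_m) (c : 'I_n -> nat) : Prop :=
  forall b, b != a -> n < 2 * #|[set j | c j <= pos P j b]|.

Definition cuttable m n (P : profile m n) (a : 'I_m) (t : nat) : Prop :=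
  exists c : 'I_n -> nat,
    [/\ forall j, c j <= pos P j a, \sum_j (pos P j a - c j) <= t & cut_wins P a c].

Section Dodgson.
Variables (m n : nat).
Implicit Types (P Q : profile m n) (a b : 'I_m).

Lemma pos_lt P j b : pos P j b < m.
Proof. exact: ltn_ord. Qed.

Lemma pos_inj P j b b' : pos P j b = pos P j b' -> b = b'.
Proof. by move=> /val_inj/perm_inj. Qed.

Lemma dodgson_score_leP P a t :
  reflect (exists2 k, k <= t & wins_after P a k) (dodgson_score_le P a t).
Proof.
apply: (iffP existsP) => [[k /andP[wk _]]|[k kt wk]].
  by exists k => //; rewrite -ltnS.
have ex : exists k, wins_after P a k by exists k.
case: (ex_minnP ex) => l wl lmin.
have lt : l < t.+1 by rewrite ltnS (leq_trans (lmin _ wk)).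
exists (Ordinal lt); rewrite /is_dodgson_score wl; apply/forallP => i.
by apply: contraL (ltn_ord i) => /lmin; rewrite -leqNgt.
Qed.

Definition swap P (j : 'I_n) (i i' : 'I_m) : profile m n :=
  [ffun k => if k == j then (tperm i i' * P k)%g else P k].

Lemma pos_swap P j i i' k b :
  pos (swap P j i i') k b =
  if k == j then (tperm i i' ((P k)^-1%g b) : nat) else pos P k b.
Proof.
rewrite /pos ffunE; case: eqP => // _.
by rewrite invMg tpermV permM.
Qed.

Lemma wins_afterP P a k :
  reflect (exists s : seq (profile m n), [/\ size s = k,
    path (@adjacent_exchange m n) P s & condorcet_winner (last P s) a])
  (wins_after P a k).
Proof.
apply: (iffP existsP) => [[s /andP[ps cs]]|[s [/eqP ss ps cs]]].
  by exists s; rewrite size_tuple.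
by exists (Tuple ss); rewrite /= ps cs.
Qed.

Lemma condorcet_cut_wins P a :
  condorcet_winner P a <-> cut_wins P a (fun j => pos P j a).
Proof.
have E b : b != a -> [set j | prefers (P j) a b] = [set j | pos P j a <= pos P j b].
  move=> ba; apply/setP => j; rewrite !inE /prefers /pos ltn_neqAle.
  case: eqP => // /(@pos_inj P) ab; by rewrite ab eqxx in ba.
split=> [/forallP h b ba|h].
  by have := h b; rewrite ba -E.
by apply/forallP => b; apply/implyP => ba; rewrite E ?h.
Qed.

Lemma cut_wins_sub P Q a (c d : 'I_n -> nat) :
  (forall j b, b != a -> c j <= pos P j b -> d j <= pos Q j b) ->
  cut_wins P a c -> cut_wins Q a d.
Proof.
move=> h cw b ba; apply: leq_trans (cw b ba) _.
by rewrite leq_mul2l; apply: subset_leq_card; apply/subsetP => j; rewrite !inE => /h->.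
Qed.

(** Any exchange, whether or not it involves [a], can be traded for at most one unit of lift of [a];
    hence sequences that only lift [a] are optimal. *)
Lemma cuttable_exchange P Q a t :
  adjacent_exchange P Q -> cuttable Q a t -> cuttable P a t.+1.
Proof.
case/existsP=> j /existsP[i /existsP[i' /andP[/eqP ii' /eqP ->]]].
rewrite -/(swap P j i i') => -[c [cle cs cw]].
(* The exchange affects which alternatives stand at position [c j] or lower in the ranking only when
   [c j] is [i']. The cut then moves up to [i], covering both alternatives, for one more exchange.
   If the exchange raises [a] itself, then [c j <= i] and the cut stays. *)
pose e := if c j == i' then (i : nat) else c j.
pose d k := if k == j then minn e (pos P j a) else c k.
have swapj b : (pos (swap P j i i') j b : nat) =
    if pos P j b == i then (i' : nat) else if pos P j b == i' then (i : nat) else pos P j b.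
  rewrite pos_swap eqxx /pos; case: tpermP => [->|->|].
  - by rewrite eqxx.
  - by rewrite eqxx; case: eqP => // ->.
  - by move=> /eqP/negPf h1 /eqP/negPf h2; rewrite -!val_eqE /= in h1 h2; rewrite h1 h2.
have swapk k b : k != j -> pos (swap P j i i') k b = pos P k b.
  by move=> kj; rewrite pos_swap (negPf kj).
exists d; split=> [k||].
- rewrite /d; case: eqP => [->|/eqP kj]; first by rewrite geq_minr.
  by rewrite -(swapk _ _ kj) cle.
- rewrite (bigD1 j) //= /d eqxx.
  rewrite (bigD1 j) //= in cs.
  rewrite (eq_bigr (fun k => pos (swap P j i i') k a - c k)); last first.
    by move=> k kj; rewrite (negPf kj) swapk.
  move: cs (cle j); rewrite swapj /e; move: (\sum_(k | _) _) (pos P j a) (c j) => S p q.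
  by do ! case: (_ =P _) => ?; lia.
- apply: cut_wins_sub cw => k b ba; rewrite /d; case: eqP => [->|/eqP kj]; last first.
    by rewrite swapk.
  rewrite swapj /e => h; rewrite geq_min.
  have : pos P j a != pos P j b by apply: contra ba => /eqP/pos_inj ->.
  have := cle j; rewrite swapj.
  move: h; move: (pos P j a) (pos P j b) (c j) => p p' q.
  by do ! case: (_ =P _) => ?; lia.
Qed.

(** Induction on the total lift: [a] is exchanged with the alternative just above it in some ranking
    where it has not yet reached the cut. Rivals only move down, so those within the cut stay
    there. *)
Lemma cuttable_wins P a (c : 'I_n -> nat) :
  (forall j, c j <= pos P j a) -> cut_wins P a c ->
  wins_after P a (\sum_j (pos P j a - c j)).
Proof.
move E: (\sum_j _) => k; elim: k P E => [|k IH] P E cle cw.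
  apply/wins_afterP; exists [::]; split=> //=; apply/condorcet_cut_wins.
  apply: cut_wins_sub cw => j b _; have le : pos P j a <= c j; last exact: leq_trans le.
  move/eqP: E; rewrite sum_nat_eq0 => /forallP/(_ j) /=.
  by rewrite subn_eq0.
have [j lt_j] : exists j, c j < pos P j a.
  apply/existsP; case: existsP => // h; move: E; rewrite big1 // => j _.
  by apply/eqP; rewrite subn_eq0 leqNgt; apply/negP => lt_j; case: h; exists j.
have i_lt : (pos P j a).-1 < m by have := pos_lt P j a; lia.
pose i := Ordinal i_lt; pose i' := ((P j)^-1)%g a.
have ii' : i' = i.+1 :> nat by rewrite /= /i' -/(pos P j a) prednK //; lia.
pose Q := swap P j i i'.
have posQk k' b : k' != j -> pos Q k' b = pos P k' b.
  by move=> h; rewrite pos_swap (negPf h).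
have posQja : pos Q j a = (pos P j a).-1 by rewrite pos_swap eqxx tpermR.
have posQj b : b != a -> pos P j b <= pos Q j b.
  move=> ba; rewrite pos_swap eqxx /pos; case: tpermP => [->|/perm_inj|//].
    by rewrite ii'.
  by move=> e; rewrite e eqxx in ba.
have /wins_afterP[s [ss ps cs]] : wins_after Q a k.
  apply: IH.
  - move: E; rewrite (bigD1 j) //= [in X in _ -> X](bigD1 j) //= posQja.
    rewrite [in X in _ -> X](eq_bigr (fun k => pos P k a - c k)); last first.
      by move=> k' h; rewrite posQk.
    by move: lt_j; lia.
  - move=> k'; case: (eqVneq k' j) => [->|h]; last by rewrite posQk.
    by rewrite posQja; move: lt_j; lia.
  - apply: cut_wins_sub cw => k' b ba; case: (eqVneq k' j) => [->|h]; last by rewrite posQk.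
    by move=> /leq_trans; apply; apply: posQj.
apply/wins_afterP; exists (Q :: s); split=> //=; first by rewrite ss.
rewrite ps andbT; apply/existsP; exists j; apply/existsP; exists i.
by apply/existsP; exists i'; rewrite ii' !eqxx.
Qed.

Lemma dodgson_cuttable P a t : dodgson_score_le P a t <-> cuttable P a t.
Proof.
split=> [/dodgson_score_leP[k kt /wins_afterP[s [ss ps cs]]]|[c [cle cs cw]]].
  suff [c [h1 h2 h3]] : cuttable P a k by exists c; split=> //; apply: leq_trans kt.
  rewrite -{k kt}ss; elim: s P ps cs => [|Q s IH] P /=.
    move=> _ /condorcet_cut_wins cw; exists (fun j => pos P j a); split=> //.
    by rewrite big1 // => j _; rewrite subnn.
  by case/andP=> pq ps cs; apply: cuttable_exchange pq (IH _ ps cs).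
apply/dodgson_score_leP; exists (\sum_j (pos P j a - c j)) => //.
exact: cuttable_wins.
Qed.

(** * Deficits as lower and upper bounds on the score *)

Definition wins_over P a b := #|[set j | pos P j a < pos P j b]|.

(* Agents already preferring [a] to [b], or made to by a single exchange. *)
Definition near_over P a b :=
  #|[set j | (pos P j a < pos P j b) || (pos P j a == (pos P j b).+1)]|.

(** [n./2.+1] is the least strict majority; truncated subtraction gives 0 for a rival that is
    already beaten. *)
Definition deficit P a b := n./2.+1 - wins_over P a b.

(** Double counting of the pairs of a rival and an agent whose lift passes it: each rival requires
    at least its deficit of such agents, and the rivals passed in one ranking occupy distinct
    positions between the cut and [a]. *)
Lemma deficit_le P a t : dodgson_score_le P a t ->
  \sum_(b | b != a) deficit P a b <= t.
Proof.
move/dodgson_cuttable=> [c [cle cs cw]]; apply: leq_trans cs.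
pose g b j := (c j <= pos P j b < pos P j a)%N.
apply: (@leq_trans (\sum_(b | b != a) \sum_j g b j)).
  apply: leq_sum => b ba; rewrite /deficit /wins_over.
  have := cw b ba; rewrite -!sum1dep_card.
  suff : \sum_(j | c j <= pos P j b) 1 <= \sum_(j | pos P j a < pos P j b) 1 + \sum_j g b j.
    by have := odd_double_half n; rewrite -muln2; lia.
  rewrite big_mkcond [in X in _ <= X + _]big_mkcond -big_split /=; apply: leq_sum => j _.
  rewrite /g; have : pos P j a != pos P j b by apply: contra ba => /eqP/pos_inj ->.
  by case: ifP; case: ifP; lia.
rewrite exchange_big /=; apply: leq_sum => j _.
pose h (b : 'I_m) : nat := pos P j b.
have hinj : injective h by move=> b b'; apply: pos_inj.
rewrite -big_mkcondr /= sum1_card.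
rewrite -(size_iota (c j) (pos P j a - c j)) cardE -(size_map h).
apply: uniq_leq_size; first by rewrite map_inj_uniq ?enum_uniq.
move=> x /mapP[b]; rewrite mem_enum => /andP[_ hb] ->; rewrite mem_iota /h.
by have := cle j; move: hb; rewrite /g; lia.
Qed.

(** For each rival, [near] leaves enough agents with that rival immediately above [a] to fill the
    deficit, and a single exchange suffices at each of them. *)
Lemma deficit_ge P a t : (forall b, b != a -> n < 2 * near_over P a b) ->
  \sum_(b | b != a) deficit P a b <= t -> dodgson_score_le P a t.
Proof.
move=> near dt; apply/dodgson_cuttable.
pose D b := [set j | pos P j a == (pos P j b).+1].
pose S b := [set j in take (deficit P a b) (enum (D b))].
have SD b j : j \in S b -> pos P j a = (pos P j b).+1.
  by rewrite inE => /mem_take; rewrite mem_enum inE => /eqP.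
(* The lift of agent [j] is the number of rivals that selected [j]. Summed over the agents this is
   the sum of the deficits, and a selected agent is lifted by at least one, which passes the rival
   just above [a]. *)
pose x j := \sum_(b | b != a) (j \in S b : nat).
have cS b : b != a -> #|S b| = deficit P a b.
  move=> ba; rewrite cardsE (card_uniqP _) ?take_uniq ?enum_uniq //.
  rewrite size_takel // -cardE /deficit.
  have := near b ba; rewrite /near_over /wins_over /D.
  have -> : [set j | (pos P j a < pos P j b) || (pos P j a == (pos P j b).+1)] =
     [set j | pos P j a < pos P j b] :|: [set j | pos P j a == (pos P j b).+1].
    by apply/setP => j; rewrite !inE.
  rewrite cardsU; have := odd_double_half n; rewrite -muln2; lia.
exists (fun j => pos P j a - x j); split.
- by move=> j; apply: leq_subr.
- apply: leq_trans dt; apply: (@leq_trans (\sum_j x j)).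
    by apply: leq_sum => j _; lia.
  rewrite exchange_big /=; apply: leq_sum => b ba.
  rewrite -cS // -sum1_card [X in _ <= X]big_mkcond; apply: leq_sum => j _.
  by case: (j \in S b).
- move=> b ba.
  apply: (@leq_trans (2 * #|[set j | pos P j a < pos P j b] :|: S b|)).
    rewrite cardsU; have -> : [set j | pos P j a < pos P j b] :&: S b = set0.
      apply/setP => j; rewrite inE in_set0 inE; apply/negP => /andP[h /SD]; lia.
    rewrite cards0 subn0 cS // /deficit /wins_over.
    by have := odd_double_half n; rewrite -muln2; lia.
  rewrite leq_mul2l; apply: subset_leq_card; apply/subsetP => j.
  rewrite !inE => /orP[|jS]; first lia.
  have h1 : j \in S b by rewrite inE.
  have : 0 < x j by rewrite /x (bigD1 b) //= h1.
  by have := SD _ _ h1; lia.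
Qed.

Definition greedy P a t : answer :=
  if [forall (b | b != a), n < 2 * near_over P a b]
  then Some (\sum_(b | b != a) deficit P a b <= t) else None.

Lemma greedy_correct P a t r :
  greedy P a t = Some r -> r = dodgson_score_le P a t.
Proof.
rewrite /greedy; case: ifP => // /forall_inP near [<-].
by apply/idP/idP => [/(deficit_ge near)|/deficit_le].
Qed.

End Dodgson.

(** * Programs *)

Section Machine.
Variable w : seq nat.
Implicit Types (s : memory) (c : prog) (Q : memory -> Prop).

Fixpoint loop_free c : bool :=
  match c with
  | Seq c1 c2 | If _ c1 c2 => loop_free c1 && loop_free c2
  | While _ _ => false
  | _ => true
  end.

Fixpoint eval c s : memory :=
  match c with
  | Const x v => upd s x v
  | Add x y z => upd s x (s y + s z)
  | Sub x y z => upd s x (s y - s z)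
  | Get x y => upd s x (s (s y))
  | Put x y => upd s (s x) (s y)
  | Read x y => upd s x (nth 0 w (s y))
  | Seq c1 c2 => eval c2 (eval c1 s)
  | If x c1 c2 => if s x != 0 then eval c1 s else eval c2 s
  | _ => s
  end.

Fixpoint cost c : nat :=
  match c with
  | Seq c1 c2 => cost c1 + cost c2
  | If _ c1 c2 => (cost c1 + cost c2).+1
  | _ => 1
  end.

(** Total correctness with an upper bound on the number of steps. The precondition is a concrete
    initial memory, so that loop-free code can be executed symbolically. *)
Definition runs c T s Q := exists s' k, [/\ exec w c s s' k, Q s' & k <= T].

Lemma runs_eval c s Q : loop_free c -> Q (eval c s) -> runs c (cost c) s Q.
Proof.
move=> lf Qs; exists (eval c s).
suff [k [ek kc]] : exists k, exec w c s (eval c s) k /\ k <= cost c by exists k.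
elim: c s lf {Qs} => //=; try by move=> *; exists 1; split=> //; constructor.
- move=> c1 IH1 c2 IH2 s /andP[/(IH1 s)[k1 [e1 l1]] /(IH2 (eval c1 s))[k2 [e2 l2]]].
  by exists (k1 + k2); split; [apply: ExecSeq e2|apply: leq_add].
- move=> x c1 IH1 c2 IH2 s /andP[/(IH1 s)[k1 [e1 l1]] /(IH2 s)[k2 [e2 l2]]].
  case: (eqVneq (s x) 0) => h /=.
    by exists k2.+1; split; [apply: ExecIfF|lia].
  by exists k1.+1; split; [apply: ExecIfT|lia].
Qed.

Lemma runs_seq c1 c2 T1 T2 s Q1 Q : runs c1 T1 s Q1 ->
  (forall s1, Q1 s1 -> runs c2 T2 s1 Q) -> runs (Seq c1 c2) (T1 + T2) s Q.
Proof.
move=> [s1 [k1 [e1 q1 l1]]] /(_ _ q1)[s2 [k2 [e2 q2 l2]]].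
by exists s2, (k1 + k2); split=> //; [apply: ExecSeq e2|apply: leq_add].
Qed.

Lemma runs_if x c1 c2 T s Q :
  (s x != 0 -> runs c1 T s Q) -> (s x = 0 -> runs c2 T s Q) ->
  runs (If x c1 c2) T.+1 s Q.
Proof.
case: (eqVneq (s x) 0) => h.
  by move=> _ /(_ h)[s' [k [e q l]]]; exists s', k.+1; split=> //; apply: ExecIfF.
by move=> /(_ isT)[s' [k [e q l]]] _; exists s', k.+1; split=> //; apply: ExecIfT.
Qed.

(** The invariant is indexed by the number of completed iterations and [N] is their exact number,
    which gives termination and the cost together. The final 1 pays for the test that leaves the
    loop. *)
Lemma runs_while x c (N T : nat) s Q (I : nat -> memory -> Prop) :
  I 0 s ->
  (forall i s1, i < N -> I i s1 -> s1 x != 0 /\ runs c T s1 (I i.+1)) ->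
  (forall s1, I N s1 -> s1 x = 0 /\ Q s1) ->
  runs (While x c) (N * T.+1 + 1) s Q.
Proof.
move=> I0 step fin.
suff H d : d <= N -> forall s1, I (N - d) s1 -> runs (While x c) (d * T.+1 + 1) s1 Q.
  by apply: H; rewrite ?subnn.
elim: d => [|d IH] dN s1 Is.
  rewrite subn0 in Is; have [x0 Qs] := fin _ Is.
  by exists s1, 1; split=> //; apply: ExecWhileF.
have [|x0 [s2 [k [e2 I2 l2]]]] := step _ _ _ Is; first lia.
rewrite subnSK // in I2; have [s3 [k' [e3 Q3 l3]]] := IH (ltnW dN) _ I2.
exists s3, (k + k').+1; split=> //; first by apply: ExecWhileT e3.
by rewrite mulSn; lia.
Qed.

Lemma runs_le c T T' s Q Q' : runs c T s Q -> T <= T' ->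
  (forall s', Q s' -> Q' s') -> runs c T' s Q'.
Proof.
by move=> [s' [k [e q l]]] TT QQ; exists s', k; split; [| apply: QQ | apply: leq_trans TT].
Qed.

Lemma runs_leT c T T' s Q : runs c T s Q -> T <= T' -> runs c T' s Q.
Proof. by move=> r l; apply: runs_le r l _. Qed.

Lemma upd_ne s x v y : y != x -> upd s x v y = s y.
Proof. by rewrite /upd => /negPf ->. Qed.

Lemma upd_eq s x v : upd s x v x = v.
Proof. by rewrite /upd eqxx. Qed.

End Machine.

Definition block (l : seq prog) : prog := foldr Seq Skip l.

Lemma runs_cons w c l T1 T2 s Q1 Q : runs w c T1 s Q1 ->
  (forall s1, Q1 s1 -> runs w (block l) T2 s1 Q) ->
  runs w (block (c :: l)) (T1 + T2) s Q.
Proof. exact: runs_seq. Qed.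

Lemma runs_step w c l T s (Q : memory -> Prop) : loop_free c ->
  runs w (block l) T (eval w c s) Q -> runs w (block (c :: l)) (cost c + T) s Q.
Proof.
move=> lf r; apply: (runs_cons (Q1 := fun s' => s' = eval w c s)).
  exact: runs_eval.
by move=> s1 ->.
Qed.

Lemma runs_nil w s (Q : memory -> Prop) : Q s -> runs w (block [::]) 1 s Q.
Proof. by move=> Qs; exists s, 1; split=> //; constructor. Qed.

Section Steps.
Variables (w : seq nat) (l : seq prog) (T : nat) (s : memory) (Q : memory -> Prop).

Lemma runs_const x v : runs w (block l) T (upd s x v) Q ->
  runs w (block (Const x v :: l)) T.+1 s Q.
Proof. exact: (fun r => @runs_step w (Const x v) l T s Q (erefl true) r). Qed.

Lemma runs_add x y z u v : s y = u -> s z = v ->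
  runs w (block l) T (upd s x (u + v)) Q -> runs w (block (Add x y z :: l)) T.+1 s Q.
Proof. move=> <- <-; exact: (fun r => @runs_step w (Add x y z) l T s Q (erefl true) r). Qed.

Lemma runs_sub x y z u v : s y = u -> s z = v ->
  runs w (block l) T (upd s x (u - v)) Q -> runs w (block (Sub x y z :: l)) T.+1 s Q.
Proof. move=> <- <-; exact: (fun r => @runs_step w (Sub x y z) l T s Q (erefl true) r). Qed.

Lemma runs_get x y p v : s y = p -> s p = v ->
  runs w (block l) T (upd s x v) Q -> runs w (block (Get x y :: l)) T.+1 s Q.
Proof. move=> <- <-; exact: (fun r => @runs_step w (Get x y) l T s Q (erefl true) r). Qed.

Lemma runs_put x y p v : s x = p -> s y = v ->
  runs w (block l) T (upd s p v) Q -> runs w (block (Put x y :: l)) T.+1 s Q.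
Proof. move=> <- <-; exact: (fun r => @runs_step w (Put x y) l T s Q (erefl true) r). Qed.

Lemma runs_read x y p v : s y = p -> nth 0 w p = v ->
  runs w (block l) T (upd s x v) Q -> runs w (block (Read x y :: l)) T.+1 s Q.
Proof. move=> <- <-; exact: (fun r => @runs_step w (Read x y) l T s Q (erefl true) r). Qed.

Lemma runs_skip : runs w (block l) T s Q -> runs w (block (Skip :: l)) T.+1 s Q.
Proof. exact: (fun r => @runs_step w (Skip) l T s Q (erefl true) r). Qed.

(** Splices a nested block into the surrounding one, so that symbolic execution sees a flat list;
    the extra step pays for the [Skip] closing the inner block. *)
Lemma runs_block l' : runs w (block (l' ++ l)) T s Q ->
  runs w (block (block l' :: l)) T.+1 s Q.
Proof.
move=> [s' [k [e Qs kT]]]; exists s', k.+1; split=> //; move: e {Qs kT}.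
elim: l' s k => [|c l' IH] s0 k /= e; first by apply: (ExecSeq (ExecSkip w s0) e).
inversion e as [| | | | | | |c1 c2 s1 s2 s3 k1 k2 e1 e2| | | |]; subst.
have e3 := IH _ _ e2.
inversion e3 as [| | | | | | |c1 c2 u1 u2 u3 k3 k4 e4 e5| | | |]; subst.
have -> : (k1 + k2).+1 = k1 + k3 + k4 by lia.
by apply: (ExecSeq (ExecSeq e1 e4) e5).
Qed.

Lemma runs_if_true x c1 c2 v : s x = v -> v != 0 ->
  runs w (block (c1 :: l)) T s Q -> runs w (block (If x c1 c2 :: l)) T.+1 s Q.
Proof.
move=> <- v0 [s' [k [e Qs kT]]]; exists s', k.+1; split=> //; move: e {Qs kT} => /= e.
inversion e; subst; rewrite -addSn; apply: ExecSeq; last by eassumption.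
exact: ExecIfT.
Qed.

Lemma runs_if_false x c1 c2 : s x = 0 ->
  runs w (block (c2 :: l)) T s Q -> runs w (block (If x c1 c2 :: l)) T.+1 s Q.
Proof.
move=> v0 [s' [k [e Qs kT]]]; exists s', k.+1; split=> //; move: e {Qs kT} => /= e.
inversion e; subst; rewrite -addSn; apply: ExecSeq; last by eassumption.
exact: ExecIfF.
Qed.

End Steps.

Lemma runs_last w T s (Q : memory -> Prop) : Q s -> runs w (block [::]) T.+1 s Q.
Proof. by move=> Qs; apply: runs_leT (runs_nil _ Qs) _. Qed.

(** Symbolic execution: a read is resolved through the pending updates, with [lia] telling the cells
    apart. *)
Ltac upds := rewrite /=;
  repeat first [rewrite upd_eq | rewrite upd_ne; last by [ | lia]].
Ltac look := upds; first [eassumption | reflexivity].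
Ltac step := first
  [ eapply runs_const | eapply runs_add; [look | look | ]
  | eapply runs_sub; [look | look | ] | eapply runs_get; [look | look | ]
  | eapply runs_put; [look | look | ] | eapply runs_block; rewrite /cat | eapply runs_skip ].
Ltac steps := repeat step.

(** * The layout of the encoded input *)

Section Encode.
Variables (m n : nat) (P : profile m n) (a : 'I_m) (t : nat).
Let w := encode P a t.

Lemma size_encode : size w = 4 + n * m.
Proof.
rewrite /w /encode /= size_flatten /shape -map_comp.
rewrite (eq_map (g := fun=> m)) => [|j /=]; last by rewrite size_map size_enum_ord.
by rewrite sumnE big_map big_const_seq count_predT size_enum_ord iter_addn_0 mulnC.
Qed.

Lemma nth_encode (j : 'I_n) (i : 'I_m) : nth 0 w (4 + (j * m + i)) = P j i.
Proof.
rewrite /w /encode [LHS]/=.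
pose ss := [seq [seq val (P k l) | l <- enum 'I_m] | k <- enum 'I_n].
have hs : shape ss = nseq n m.
  have e : size (shape ss) = n by rewrite 2!size_map size_enum_ord.
  rewrite -[X in nseq X]e.
  apply/all_pred1P/allP => x; rewrite /shape -map_comp => /mapP[k _ ->] /=.
  by rewrite size_map size_enum_ord.
have ih : i < nth 0 (shape ss) j by rewrite hs nth_nseq ltn_ord.
have -> : j * m + i = flatten_index (shape ss) j i.
  by rewrite /flatten_index hs take_nseq ?sumn_nseq ?(mulnC m) // ltnW.
rewrite add0n -/ss nth_flatten flatten_indexKl // flatten_indexKr //.
rewrite (nth_map j) ?size_enum_ord // nth_ord_enum.
by rewrite (nth_map i) ?size_enum_ord // nth_ord_enum.
Qed.

End Encode.

(* Cells 0, 1, 2, 3, 4, 5 hold 0, m, n, a, t, 1. *)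
Definition load : prog :=
  block [:: Const 5 1; Read 1 0; Read 2 5; Add 6 5 5; Read 3 6; Add 6 6 5; Read 4 6].

(* Runs body on each position of each ranking, from the bottom up, with the
   alternative there in cell 10. Cell 6 counts the remaining agents, cell 9 the
   remaining positions, cell 7 points to the end of the row and cell 8 reads it. *)
Definition scan (pre body post : prog) : prog :=
  block [:: Const 7 4; Add 6 2 0;
    While 6 (block [:: Add 7 7 1; Add 8 7 0; Add 9 1 0; pre;
      While 9 (block [:: Sub 8 8 5; Read 10 8; body; Sub 9 9 5]);
      post; Sub 6 6 5])].

(** * Correctness of the traversal of the profile *)

Section Scan.
Variables (m n : nat) (P : profile m n) (a : 'I_m) (t : nat).
Let w := encode P a t.

Definition loaded (s : memory) :=
  [/\ s 0 = 0, s 1 = m, s 2 = n, s 3 = a :> nat & s 4 = t /\ s 5 = 1].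

(** Cells 6 to 10 are the registers of [scan], so its invariants must survive arbitrary writes
    there. *)
Definition stable (Q : memory -> Prop) :=
  forall s x v, 6 <= x <= 10 -> Q s -> Q (upd s x v).

(** The inserted code may overwrite cell 10, but not the counters and pointers of the traversal. *)
Definition control (s s' : memory) := forall x, 6 <= x <= 9 -> s' x = s x.

Lemma run_load : runs w load 10 (fun=> 0) (fun s =>
  loaded s /\ forall y, 6 < y -> s y = 0).
Proof.
step; do 2 (eapply runs_read; [look | reflexivity |]).
step; eapply runs_read; [look | reflexivity |].
step; eapply runs_read; [look | reflexivity |].
by apply: runs_last; split; [split; [| | | | split] |]; upds => // y hy; upds.
Qed.

(** [J j] holds between rows, when [j] agents are done; [I j i] holds inside row [j], when the
    positions from [i] on have been read. *)
Variables (J : nat -> memory -> Prop) (I : 'I_n -> nat -> memory -> Prop).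
Variables (pre body post : prog) (T1 T2 T3 : nat).
Hypothesis J_loaded : forall j s, J j s -> loaded s.
Hypothesis I_loaded : forall j i s, I j i s -> loaded s.
Hypothesis J_stable : forall j, stable (J j).
Hypothesis I_stable : forall j i, stable (I j i).
Hypothesis run_pre : forall (j : 'I_n) s, J j s ->
  runs w pre T1 s (fun s' => I j m s' /\ control s s').
Hypothesis run_body : forall (j : 'I_n) (i : 'I_m) s, I j i.+1 s -> s 10 = P j i ->
  runs w body T2 s (fun s' => I j i s' /\ control s s').
Hypothesis run_post : forall (j : 'I_n) s, I j 0 s ->
  runs w post T3 s (fun s' => J j.+1 s' /\ control s s').

Lemma scan_row (j : 'I_n) s : I j m s -> s 9 = m -> s 8 = 4 + j.+1 * m ->
  runs w (While 9 (block [:: Sub 8 8 5; Read 10 8; body; Sub 9 9 5]))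
    (m * (T2 + 4).+1 + 1) s
    (fun s' => [/\ I j 0 s', s' 6 = s 6 & s' 7 = s 7]).
Proof.
move=> Is s9 s8.
apply: (runs_while (I := fun k s' => [/\ I j (m - k) s', s' 6 = s 6, s' 7 = s 7,
  s' 9 = m - k & s' 8 = 4 + j * m + (m - k)])).
- by rewrite subn0; split=> //; rewrite s8 mulSn; lia.
- move=> k s1 km [Is1 e6 e7 e9 e8].
  have lt : m - k.+1 < m by lia.
  have [_ s1m _ _ [_ s5]] := I_loaded Is1.
  split; first by rewrite e9; lia.
  eapply runs_leT.
    do 2 apply: runs_step => //.
    eapply runs_cons.
      apply: (run_body (j := j) (i := Ordinal lt)) => /=.
        by do 2 apply: I_stable => //; rewrite subnSK.
      upds; rewrite e8 s5 -(nth_encode P a t); congr nth.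
      by rewrite /=; lia.
    move=> s2 [Is2 c2]; apply: runs_step => //.
    have [_ _ _ _ [_ s25]] := I_loaded Is2.
    apply: runs_nil; split; upds; rewrite ?s25 ?c2 //; upds; rewrite ?e8 ?e9 ?s5 //; first last.
    - by lia.
    - by lia.
    exact: I_stable.
  by rewrite /=; lia.
- by move=> s1 []; rewrite subnn.
Qed.

Lemma run_scan s : (forall s', loaded s' -> (forall x, x < 6 \/ 10 < x -> s' x = s x) -> J 0 s') ->
  loaded s ->
  runs w (scan pre body post) (n * (T1 + T3 + m * (T2 + 5) + 10) + 5) s (J n).
Proof.
move=> J0 [s0 sm sn sa [st s5]].
have L0 : J 0 (eval w (Add 6 2 0) (eval w (Const 7 4) s)).
  apply: J0; first by split; upds.
  by move=> x hx; upds.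
eapply runs_leT.
  do 2 apply: runs_step => //.
  eapply runs_cons; last by move=> s1 Js; apply: runs_nil; exact: Js.
  apply: (runs_while (N := n) (I := fun k s' => [/\ J k s', s' 6 = n - k & s' 7 = 4 + k * m])).
  - by split=> //; upds; rewrite ?sn ?s0; lia.
  - move=> k s1 kn [Js1 e6 e7].
    have [r0 rm rn ra [rt r5]] := J_loaded Js1.
    split; first by rewrite e6; lia.
    do 3 apply: runs_step => //.
    eapply runs_cons.
      by apply: (run_pre (j := Ordinal kn)) => /=; do 3 apply: J_stable => //.
    move=> s2 [Is2 c2]; eapply runs_cons.
      apply: (scan_row Is2); rewrite c2 //; upds; rewrite ?rm ?r0 ?e7 //=; lia.
    move=> s3 [Is3 d6 d7]; eapply runs_cons; first exact: (run_post Is3).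
    move=> s4 [Js4 c4]; apply: runs_step => //.
    have [_ _ _ _ [_ s45]] := J_loaded Js4.
    apply: runs_nil; split; first exact: J_stable.
    + by upds; rewrite c4 // d6 c2 // s45; upds; rewrite e6; lia.
    + by upds; rewrite c4 // d7 c2 //; upds; rewrite e7 rm mulSn; lia.
  - by move=> s1 [Js1 e6 _]; rewrite e6 subnn.
by rewrite /=; nia.
Qed.

End Scan.

(** * The greedy program *)

(* Cells 2 x + 24 and 2 x + 25 count the agents preferring a to x and those also
   doing so after at most one exchange. In a row read from the bottom, cells 12 and
   13 hold 1 as long as the next alternative falls in the respective case. *)
Definition tally_step : prog :=
  block [:: Sub 16 10 3; Sub 17 3 10; Add 16 16 17;
    If 16 (block [:: Add 14 10 10; Add 14 14 11; Get 15 14; Add 15 15 12; Put 14 15;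
                     Add 14 14 5; Get 15 14; Add 15 15 13; Put 14 15; Add 13 12 0])
          (Const 12 0)].

(* Cell 18 holds n / 2 + 1, cell 19 the sum of the deficits, cell 20 a failure flag. *)
Definition greedy_check : prog :=
  block [:: Const 18 1; Sub 16 2 5;
    While 16 (block [:: Add 18 18 5; Const 17 2; Sub 16 16 17]);
    Add 9 1 0;
    While 9 (block [:: Sub 9 9 5; Sub 16 9 3; Sub 17 3 9; Add 16 16 17;
      If 16 (block [:: Add 14 9 9; Add 14 14 11; Get 15 14; Sub 15 18 15; Add 19 19 15;
                       Add 14 14 5; Get 15 14; Add 15 15 15; Sub 15 15 2;
                       If 15 Skip (Const 20 1)])
            Skip]);
    Sub 16 19 4;
    If 20 Skip (If 16 (Const 0 2) (Const 0 1))].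

Definition greedy_prog : prog :=
  block [:: Const 11 24;
    scan (block [:: Const 12 1; Const 13 1]) tally_step Skip;
    greedy_check].

Lemma sum_le_ord m (Q : pred 'I_m) (F : 'I_m -> nat) (i : 'I_m) :
  \sum_(b | Q b && (i <= b)) F b =
  \sum_(b | Q b && (i < b)) F b + (if Q i then F i else 0).
Proof.
have E (b : 'I_m) : Q b && (i <= b) && (b != i) = Q b && (i < b).
  by rewrite -andbA; congr andb; rewrite ltn_neqAle andbC -val_eqE eq_sym.
case: ifP => Qi.
  by rewrite (bigD1 i) /= ?Qi ?leqnn // addnC (eq_bigl _ _ E).
rewrite addn0; apply: eq_bigl => b; rewrite -E.
by case: (eqVneq b i) => [->|]; rewrite ?Qi ?andbT.
Qed.

(** * Correctness of the greedy program *)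

Section Greedy.
Variables (m n : nat) (P : profile m n) (a : 'I_m) (t : nat).
Let w := encode P a t.

(** The value of a counter partway through the traversal: all rows before [j] are done, and row [j]
    has been read from the bottom up to position [i]. *)
Definition tally (f : 'I_n -> 'I_m -> bool) (j i : nat) (x : 'I_m) : nat :=
  \sum_(k < n) (((k < j) || (k == j :> nat) && (i <= pos P k x)) && f k x).

Lemma tally0 f x : tally f 0 m x = 0.
Proof.
by rewrite /tally big1 // => k _; rewrite [m <= _]leqNgt pos_lt andbF.
Qed.

Lemma tally_row f (j : 'I_n) x : tally f j.+1 m x = tally f j 0 x.
Proof.
apply: eq_bigr => k _; rewrite [m <= _]leqNgt pos_lt andbF orbF andbT.
by rewrite ltnS leq_eqVlt orbC.
Qed.

Lemma tally_full f x : tally f n m x = #|[set k | f k x]|.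
Proof.
rewrite -sum1dep_card [RHS]big_mkcond; apply: eq_bigr => k _.
by rewrite ltn_ord; case: (f k x).
Qed.

Lemma tallyS f (j : 'I_n) i x :
  tally f j i x = tally f j i.+1 x + ((pos P j x == i) && f j x).
Proof.
rewrite /tally [LHS](bigD1 j) //= [X in _ = X + _](bigD1 j) //= eqxx ltnn /=.
rewrite addnAC; congr (_ + _); first by case: (f j x); lia.
by apply: eq_bigr => k; rewrite -val_eqE /= => /negPf ->.
Qed.

Let over k b := pos P k a < pos P k b.
Let nearly k b := over k b || (pos P k a == (pos P k b).+1).

Definition tallied j i (s : memory) := [/\ loaded n a t s, s 11 = 24, s 19 = 0, s 20 = 0 &
  forall x, x != a -> s (x + x + 24) = tally over j i x /\
                      s (x + x + 24 + 1) = tally nearly j i x].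

(** The next alternative to be read has position [i - 1]. If it is not [a], it is below [a] when
    [pos P j a < i], and below or immediately above [a] when [pos P j a <= i]. *)
Definition tallying (j : 'I_n) i s :=
  [/\ tallied j i s, s 12 = (pos P j a < i) & s 13 = (pos P j a <= i)].

Lemma tallied_upd j i s x v : 6 <= x < 24 -> x \notin [:: 11; 19; 20] ->
  tallied j i s -> tallied j i (upd s x v).
Proof.
rewrite !inE !negb_or => hx /and3P[x11 x19 x20] [[l0 l1 l2 l3 [l4 l5]] h11 h19 h20 h].
split; [split| | | |]; rewrite ?upd_ne //; try lia.
by move=> y /h[]; rewrite !upd_ne //; lia.
Qed.

Lemma tallied_stable j i : stable (tallied j i).
Proof. by move=> s x v hx; apply: tallied_upd; rewrite ?inE; lia. Qed.

Lemma tallying_stable (j : 'I_n) i : stable (tallying j i).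
Proof.
move=> s x v hx [h h12 h13]; split; upds => //.
exact: tallied_stable.
Qed.

Lemma pos_at (j : 'I_n) (i : 'I_m) b : (pos P j b == i) = (b == P j i).
Proof.
apply/eqP/eqP => [h|->]; last by rewrite /pos permK.
by rewrite -[b](permKV (P j)); congr (P j _); apply: val_inj.
Qed.

Lemma run_tally_step (j : 'I_n) (i : 'I_m) s : tallying j i.+1 s -> s 10 = P j i ->
  runs w tally_step 20 s (fun s' => tallying j i s' /\ control s s').
Proof.
move=> [[[l0 l1 l2 l3 [l4 l5]] h11 h19 h20 h] h12 h13] s10.
step. step. step.
(* The two truncated differences add up to the distance of the indices, which is 0 exactly when the
   alternative is [a]. *)
have [e|ne] := eqVneq (P j i) a.
  eapply runs_if_false; first by upds; rewrite e; lia.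
  step. apply: runs_last. 
  have pa : pos P j a = i by apply/eqP; rewrite pos_at e.
  split; last by move=> x hx; upds.
  split; upds; rewrite ?h13 ?pa; try lia.
  do 4 apply: tallied_upd => //; split=> // x xa.
  have : pos P j x != i by rewrite pos_at e.
  by move=> /negPf xi; have := h x xa; rewrite !(tallyS _ _ i) xi !addn0.
eapply runs_if_true; [by upds | |].
  by move: ne; rewrite -val_eqE /=; lia.
set x := P j i in ne s10 *.
have [hx1 hx2] := h x ne.
have pa : pos P j a != i by rewrite pos_at eq_sym.
have px : pos P j x = i by apply/eqP; rewrite pos_at.
steps; apply: runs_last; split; last by move=> y hy; upds.
split; upds; try lia.
split; [split| | | |]; upds => // y ya.
have [-> |yx] := eqVneq y x; upds.
  by rewrite !(tallyS _ _ i) px eqxx /nearly /over px; split; congr addn; lia.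
have [y1 y2] := h y ya; have yx' : nat_of_ord y != x by [].
have yi : (pos P j y == i) = false by rewrite pos_at; apply/negbTE.
by rewrite !(tallyS _ _ i) yi !addn0; split; upds.
Qed.

Lemma run_tallies s : loaded n a t s -> s 11 = 24 -> s 19 = 0 -> s 20 = 0 ->
  (forall x, 24 <= x -> s x = 0) ->
  runs w (scan (block [:: Const 12 1; Const 13 1]) tally_step Skip)
    (n * (m * 25 + 15) + 5) s (tallied n m).
Proof.
move=> L s11 s19 s20 s0; eapply runs_leT.
  apply: (run_scan (J := fun j => tallied j m) (I := tallying) (T1 := 3) (T2 := 20) (T3 := 1)).
  - by move=> j s1 [].
  - by move=> j i s1 [[]].
  - by move=> j; apply: tallied_stable.
  - by move=> j i; apply: tallying_stable.
  - move=> j s1 h; steps; apply: runs_last; split; last by move=> y hy; upds.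
    split; upds; rewrite ?pos_lt ?(ltnW (pos_lt _ _ _)) //.
    by do 2 apply: tallied_upd => //.
  - exact: run_tally_step.
  - move=> j s1 [[L1 h11 h19 h20 h] _ _].
    exists s1, 1; split=> //; first by constructor.
    by split=> //; split=> // x /h; rewrite !tally_row.
  - move=> s1 L1 e; split; rewrite ?e //; try lia.
    by move=> x _; rewrite !tally0 !e ?s0; lia.
  - by [].
by nia.
Qed.

Definition summed i (s : memory) := [/\ loaded n a t s,
  s 11 = 24 /\ s 18 = n./2.+1, s 9 = i /\ s 19 = \sum_(b | (b != a) && (i <= b)) deficit P a b,
  s 20 = ~~ [forall (b | b != a), (i <= b) ==> (n < 2 * near_over P a b)] &
  forall x, x != a -> s (x + x + 24) = wins_over P a x /\
                      s (x + x + 24 + 1) = near_over P a x].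

Lemma forall_le_ord (Q : pred 'I_m) (i : 'I_m) :
  [forall (b | b != a), (i <= b) ==> Q b] =
  [forall (b | b != a), (i.+1 <= b) ==> Q b] && ((i != a) ==> Q i).
Proof.
apply/forall_inP/andP => [h|[/forall_inP h1 h2] b ba].
  split; last by apply/implyP => ia; have := h i ia; rewrite leqnn.
  by apply/forall_inP => b ba; apply/implyP => ib; have := h b ba; rewrite ltnW.
apply/implyP; rewrite leq_eqVlt => /orP[/eqP/val_inj e|ib].
  by move: h2; rewrite e ba.
by have := h1 b ba; rewrite ib.
Qed.

Lemma run_greedy_check s : 0 < n -> tallied n m s ->
  runs w greedy_check (n * 4 + m * 20 + 20) s
    (fun s' => s' 0 = encode_answer (greedy P a t)).
Proof.
move=> n0 [[l0 l1 l2 l3 [l4 l5]] h11 h19 h20 h].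
eapply runs_leT.
  steps.
  eapply runs_cons.
    (* Cell 16 decreases from [n - 1] by twos and reaches 0 after [n./2] rounds, leaving the
       majority threshold in cell 18. *)
    apply: (runs_while (N := n./2) (T := 4) (I := fun k s' => [/\ tallied n m s',
      s' 18 = k.+1 & s' 16 = n - 1 - k.*2])).
    - split; upds => //; last by lia.
      by do 2 apply: tallied_upd => //.
    - move=> k s1 kn [[[g0 g1 g2 g3 [g4 g5]] g11 g19 g20 g] g18 g16].
      split; first by have := odd_double_half n; lia.
      steps; apply: runs_last; split; upds; try lia.
      by do 3 apply: tallied_upd => //.
    - move=> s1 [L1 e18 e16]; split; first by have := odd_double_half n; lia.
      exact: (conj L1 e18).
  move=> s1 [[[g0 g1 g2 g3 [g4 g5]] g11 g19 g20 g] g18].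
  steps; eapply runs_cons.
    apply: (runs_while (N := m) (T := 18) (I := fun k => summed (m - k))).
    - split; [split| |split| |]; upds => //; try lia.
      + by rewrite big1 // => b; rewrite subn0 leqNgt ltn_ord andbF.
      + rewrite g20; case: forall_inP => // -[] b _.
        by rewrite subn0 leqNgt ltn_ord.
      + by move=> x xa; have := g x xa; rewrite !tally_full; upds.
    - move=> k s2 km [[f0 f1 f2 f3 [f4 f5]] [f11 f18] [f9 f19] f20 f].
      have bm : m - k.+1 < m by lia.
      have [b bE] : exists b : 'I_m, m - k.+1 = b by exists (Ordinal bm).
      have e : m - k = b.+1 by lia.
      rewrite {}e in f9 f19 f20; rewrite {}bE.
      split; first by rewrite f9.
      step; rewrite (_ : b.+1 - 1 = b); last lia.
      do 3 step.
      have sum_b := sum_le_ord (fun x => x != a) (deficit P a) b.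
      have all_b := forall_le_ord (fun x => n < 2 * near_over P a x) b.
      have [eb|nb] := eqVneq b a.
        eapply runs_if_false; first by upds; rewrite eb; lia.
        steps; apply: runs_last; split; [split| |split| |] => //; upds => //; try lia.
        + by rewrite f19 sum_b eb eqxx addn0.
        + by rewrite f20 all_b eb eqxx andbT.
        + by move=> x /f; upds.
      have [fb1 fb2] := f b nb.
      eapply runs_if_true; [by upds| by move: nb; rewrite -val_eqE /=; lia|].
      steps.
      (* Cell 15 holds [2 * near_over P a b - n], truncated: it is nonzero exactly when the good
         agents form a strict majority. *)
      have [lt_b|ge_b] := ltnP n (2 * near_over P a b).
        eapply runs_if_true; [by upds | by lia |].
        steps; apply: runs_last; split; [split| |split| |] => //; upds => //; try lia.
        + by rewrite sum_b nb /deficit.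
        + by rewrite f20 all_b nb lt_b andbT.
        + by move=> x /f; upds.
      eapply runs_if_false; [by upds; lia |].
      steps; apply: runs_last; split; [split| |split| |] => //; upds => //; try lia.
      + by rewrite sum_b nb /deficit.
      + by rewrite all_b nb ltnNge ge_b andbF.
      + by move=> x /f; upds.
    - move=> s2; rewrite subnn => S2; split; last exact: S2.
      by case: S2 => _ _ [].
  move=> s2 [[f0 f1 f2 f3 [f4 f5]] [f11 f18] [f9 f19] f20 f].
  steps.
  move: f19; rewrite (eq_bigl (fun b => b != a)) => [f19|b]; last by rewrite andbT.
  have {}f20 : s2 20 = ~~ [forall (b | b != a), n < 2 * near_over P a b].
    by rewrite f20; congr (nat_of_bool (~~ _)); apply: eq_forallb => b.
  apply: (@runs_leT _ _ 5 5); last by [].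
  rewrite /greedy; case: ifP f20 => _ f20; last first.
    by eapply runs_if_true; [upds; exact: f20 | by [] |]; steps; apply: runs_last; upds.
  eapply runs_if_false; [by upds; exact: f20 |].
  case: leqP => le_t.
    eapply runs_if_false; [by upds; apply/eqP; rewrite subn_eq0 |].
    by steps; apply: runs_last; upds.
  eapply runs_if_true; [by upds | by rewrite subn_eq0 -ltnNge |].
  by steps; apply: runs_last; upds.
by have := odd_double_half n; lia.
Qed.

Lemma run_greedy_prog s : 0 < n -> loaded n a t s -> s 19 = 0 -> s 20 = 0 ->
  (forall x, 24 <= x -> s x = 0) ->
  runs w greedy_prog (n * (m * 25 + 15) + n * 4 + m * 20 + 30) s
    (fun s' => s' 0 = encode_answer (greedy P a t)).
Proof.
move=> n0 [l0 l1 l2 l3 [l4 l5]] s19 s20 s24; eapply runs_leT.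
  step; eapply runs_cons.
    apply: run_tallies; [by split; upds | by upds | by upds | by upds |].
    by move=> x hx; upds; apply: s24.
  move=> s1 h; eapply runs_cons; first exact: (run_greedy_check n0 h).
  by move=> s2 h2; exact: runs_nil.
by lia.
Qed.

End Greedy.

(** * The exact program *)

Section Code.
Variable B : nat.

Definition code m (v : 'I_m -> nat) : nat := \sum_(b < m) v b * B ^ b.

Lemma codeD m (v u : 'I_m -> nat) : code (fun b => v b + u b) = code v + code u.
Proof. by rewrite -big_split; apply: eq_bigr => b _; rewrite mulnDl. Qed.

Lemma eq_code m (v u : 'I_m -> nat) : v =1 u -> code v = code u.
Proof. by move=> e; apply: eq_bigr => b _; rewrite e. Qed.

Lemma codeS m (v : 'I_m.+1 -> nat) : code v = v ord0 + code (fun b => v (lift ord0 b)) * B.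
Proof.
rewrite /code big_ord_recl muln1 big_distrl /=; congr (_ + _).
by apply: eq_bigr => b _; rewrite /bump /= expnS; ring.
Qed.

Lemma code_single m (b : 'I_m) d : code (fun x => if x == b then d else 0) = d * B ^ b.
Proof.
by rewrite /code (bigD1 b) //= eqxx big1 ?addn0 // => x /negPf ->.
Qed.

Lemma code_lt m (v : 'I_m -> nat) : (forall b, v b < B) -> code v < B ^ m.
Proof.
elim: m v => [|m IH] v lt; first by rewrite /code big_ord0.
rewrite codeS expnS; have := IH _ (fun b => lt (lift ord0 b)); have := lt ord0.
by move: (code _) (B ^ m) => x y; nia.
Qed.

(** Uniqueness of the expansion: reduction modulo [B] gives the lowest digit, and cancelling [B]
    leaves the others. *)
Lemma code_inj m (v u : 'I_m -> nat) : (forall b, v b < B) -> (forall b, u b < B) ->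
  code v = code u -> v =1 u.
Proof.
elim: m v u => [|m IH] v u ltv ltu; first by move=> _ [].
rewrite !codeS => e.
have B0 : 0 < B by apply: leq_ltn_trans (ltv ord0).
have e0 : v ord0 = u ord0.
  rewrite -(modn_small (ltv ord0)) -(modnMDl (code (fun b => v (lift ord0 b))) _ B).
  by rewrite addnC e addnC modnMDl modn_small.
have es : code (fun b => v (lift ord0 b)) = code (fun b => u (lift ord0 b)).
  by apply/eqP; rewrite -(eqn_pmul2r B0); apply/eqP; lia.
move=> b; case: (unliftP ord0 b) => [b' ->|-> //].
exact: (IH _ _ (fun b => ltv _) (fun b => ltu _) es).
Qed.

End Code.

(** * Reduction to a subset-sum problem *)

Section Subset_sum.
Variables (m n : nat) (P : profile m n) (a : 'I_m) (t : nat).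

(* Making a the top of every ranking costs less than n * m exchanges. *)
Definition budget := minn t (n * m).
Definition radix := (n * m + n * m).+1.

(* Digit a counts exchanges, every other digit b the agents preferring a to b; c is
   the position to which agent j lifts a. *)
Definition gain (j : 'I_n) (c : nat) (b : 'I_m) : nat :=
  if b == a then pos P j a - c else (c <= pos P j b : nat).

(* A final slack of less than uphalf (room b) brings digit b up to target b. *)
Definition room (b : 'I_m) : nat := if b == a then budget.*2.+1 else n.

Definition target (b : 'I_m) : nat := if b == a then budget else n.

Definition valid (c : 'I_n -> nat) (o : 'I_m -> nat) :=
  (forall j, c j <= pos P j a) /\ (forall b, o b < uphalf (room b)).

(** A state of the dynamic program: the first [j] agents have chosen their lifts, and slack has been
    added to the digits from [i] on. The computation runs from [(0, m)] through [(n, m)] to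
    [(n, 0)]. *)
Definition digits j i (c : 'I_n -> nat) (o : 'I_m -> nat) (b : 'I_m) : nat :=
  \sum_(k < n | k < j) gain k (c k) b + (if i <= b then o b else 0).

Definition reach j i (z : nat) :=
  exists c o, valid c o /\ z = code radix (digits j i c o).

Lemma sum_gain_le j c b : (forall k, c k <= pos P k a) ->
  \sum_(k < n | k < j) gain k (c k) b <= if b == a then n * m else n.
Proof.
move=> vc; apply: (@leq_trans (\sum_(k < n) gain k (c k) b)).
  by rewrite big_mkcond; apply: leq_sum => k _; case: ifP.
apply: (@leq_trans (\sum_(k < n) if b == a then m else 1)).
  apply: leq_sum => k _; rewrite /gain; case: ifP => _; last exact: leq_b1.
  by rewrite (leq_trans (leq_subr _ _)) // ltnW // pos_lt.
by rewrite sum_nat_const card_ord; case: ifP; rewrite ?muln1.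
Qed.

(** Gains contribute at most [n * m] to a digit and slack at most [n * m] more; this fixes the
    choice of [radix] and excludes carries. *)
Lemma digits_lt j i c o b : 0 < n -> valid c o -> digits j i c o b < radix.
Proof.
move=> n0 [vc vo]; have := sum_gain_le j b vc; have := vo b.
have m0 : 0 < m by apply: leq_ltn_trans (ltn_ord a).
have : n <= n * m by rewrite leq_pmulr.
rewrite /digits /radix /room /budget; move: (\sum_(k < n | _) _) (n * m) => S N.
by case: ifP; case: ifP => _ _ h1 h2; lia.
Qed.

Lemma reach_lt j i z : 0 < n -> reach j i z -> z < radix ^ m.
Proof.
by move=> n0 [c [o [v ->]]]; apply: code_lt => b; apply: digits_lt.
Qed.

Lemma reach0 z : 0 < n -> reach 0 m z <-> z = 0.
Proof.
move=> n0.
have E c o : code radix (digits 0 m c o) = 0.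
  rewrite /code big1 // => b _; rewrite /digits big1 ?add0n // leqNgt ltn_ord.
  by [].
split=> [[c [o [_ ->]]]|->]; first exact: E.
exists (fun=> 0), (fun=> 0); split; last by rewrite E.
by split=> // b; rewrite /room; case: ifP => _ //; lia.
Qed.

Lemma reach_agent (j : 'I_n) z : reach j.+1 m z <->
  exists x c, [/\ reach j m x, c <= pos P j a & z = x + code radix (gain j c)].
Proof.
have E c o : code radix (digits j.+1 m c o) =
    code radix (digits j m c o) + code radix (gain j (c j)).
  rewrite -codeD; apply: eq_code => b; rewrite /digits addnAC; congr (_ + _).
  rewrite (bigD1 j) //= addnC; congr (_ + _); apply: eq_bigl => k.
  by rewrite ltnS [k < j]ltn_neqAle andbC.
split=> [[c [o [v ->]]]|[x [c [[d [o [[vd vo] ->]] cj ->]]]]].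
  exists (code radix (digits j m c o)), (c j); split; [|by case: v|exact: E].
  by exists c, o.
exists (fun k => if k == j then c else d k), o; split.
  by split=> // k; case: eqP => [->|].
rewrite E eqxx; congr (_ + _); apply: eq_code => b; rewrite /digits; congr (_ + _).
by apply: eq_bigr => k; rewrite ltn_neqAle => /andP[/negPf kj _]; rewrite -val_eqE /= kj.
Qed.

Lemma reach_room (b : 'I_m) z : reach n b z <->
  exists x d, [/\ reach n b.+1 x, d < uphalf (room b) & z = x + d * radix ^ b].
Proof.
have E c o : code radix (digits n b c o) =
    code radix (digits n b.+1 c o) + o b * radix ^ b.
  rewrite -code_single -codeD; apply: eq_code => x; rewrite /digits -addnA; congr (_ + _).
  by rewrite leq_eqVlt eq_sym val_eqE; case: eqP => [->|_] /=; rewrite ?ltnn ?add0n ?addn0.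
split=> [[c [o [v ->]]]|[x [d [[c [o [[vc vo] ->]] db ->]]]]].
  exists (code radix (digits n b.+1 c o)), (o b); split; [|by case: v|exact: E].
  by exists c, o.
exists c, (fun x => if x == b then d else o x); split.
  by split=> // y; case: eqP => [->|].
rewrite E eqxx; congr (_ + _); apply: eq_code => y; rewrite /digits; congr (_ + _).
by case: ltnP => // bx; case: eqP => // e; rewrite e ltnn in bx.
Qed.

(** For a rival, reaching [n] with a slack below [uphalf n] means that the count of agents is a
    strict majority. For [a], reaching [budget] with a slack of at most [budget] means that at most
    [budget] exchanges are made. *)
Lemma reach_target : 0 < n -> reach n 0 (code radix target) <-> dodgson_score_le P a t.
Proof.
move=> n0; have m0 : 0 < m by apply: leq_ltn_trans (ltn_ord a).
have nm : n <= n * m by rewrite leq_pmulr.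
have Da c o : digits n 0 c o a = \sum_j (pos P j a - c j) + o a.
  rewrite /digits leq0n; congr (_ + _).
  by apply: eq_big => [k|k _]; rewrite ?ltn_ord // /gain eqxx.
have Db c o b : b != a -> digits n 0 c o b = #|[set j | c j <= pos P j b]| + o b.
  move=> /negPf ba; rewrite /digits leq0n; congr (_ + _).
  rewrite -sum1dep_card [RHS]big_mkcond.
  by apply: eq_big => [k|k _]; rewrite ?ltn_ord // /gain ba; case: (_ <= _).
have gl b : target b < radix.
  by rewrite /target /radix /budget; case: ifP => _; lia.
split=> [[c [o [v e]]]|/dodgson_cuttable[c [cle cs cw]]].
  (* Both sides have all digits below [radix], so equal codes have equal digits. *)
  have {}e b : target b = digits n 0 c o b.
    by apply: (code_inj gl _ e) => x; apply: digits_lt.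
  case: v => vc vo; apply/dodgson_cuttable; exists c; split=> // [|b ba].
    by have := e a; rewrite Da /target eqxx /budget; lia.
  have := e b; rewrite Db // /target (negPf ba).
  by have := vo b; rewrite /room (negPf ba); have := uphalf_half n; have := odd_double_half n; lia.
pose o b := target b - (if b == a then \sum_j (pos P j a - c j) else #|[set j | c j <= pos P j b]|).
have sle : \sum_j (pos P j a - c j) <= n * m.
  have := sum_gain_le n a cle; rewrite eqxx; apply: leq_trans.
  by apply: eq_leq; apply: eq_big => [k|k _]; rewrite ?ltn_ord // /gain eqxx.
have cn b : #|[set j | c j <= pos P j b]| <= n by rewrite -[X in _ <= X]card_ord max_card.
exists c, o; split.
  split=> // b; rewrite /o /target /room; case: ifP => [_|/negbT ba]; first by lia.
  by have := cw b ba; have := uphalf_half n; have := odd_double_half n; lia.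
apply: eq_code => b; have [->|ba] := eqVneq b a.
  by rewrite Da /o /target eqxx /budget; lia.
by rewrite Db // /o /target (negPf ba); have := cn b; lia.
Qed.

End Subset_sum.

(* Cell 14 points to the current layer, of length cell 13; each of its members z is
   copied into the next layer as z + cell 15. *)
Definition shift : prog :=
  block [:: Add 19 14 0; Add 20 13 0;
    While 20 (block [:: Get 18 19;
      If 18 (block [:: Add 18 19 13; Add 18 18 15; Put 18 5]) Skip;
      Add 19 19 5; Sub 20 20 5])].

(* In a row read from the bottom, cell 21 becomes B ^ a once a has been met: from
   then on each alternative passed costs an exchange. *)
Definition agent_step : prog :=
  block [:: Sub 16 10 3; Sub 17 3 10; Add 16 16 17; Add 17 10 11; Get 17 17;
    If 16 (block [:: Add 15 15 17; Add 15 15 21]) (Add 21 17 0);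
    If 21 shift Skip].

Definition exact_init : prog :=
  block [:: Const 11 32; Add 9 2 0;
    While 9 (block [:: Add 12 12 1; Sub 9 9 5]);
    Sub 22 12 4; Sub 22 12 22; Add 12 12 12; Add 12 12 5;
    Const 13 1; Add 14 11 0; Add 9 1 0;
    While 9 (block [:: Put 14 13; Add 14 14 5; Const 16 0; Add 20 12 0;
      While 20 (block [:: Add 16 16 13; Sub 20 20 5]);
      Add 13 16 0; Sub 9 9 5]);
    Put 14 5].

Definition exact_rooms : prog :=
  block [:: Add 9 1 0; Const 23 0;
    While 9 (block [:: Sub 9 9 5; Sub 16 9 3; Sub 17 3 9; Add 16 16 17;
      Add 17 9 11; Get 17 17;
      If 16 (block [:: Add 24 2 0; Add 25 2 0])
            (block [:: Add 24 22 22; Add 24 24 5; Add 25 22 0]);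
      While 25 (block [:: Add 23 23 17; Sub 25 25 5]);
      Const 15 0;
      While 24 (block [:: shift; Add 15 15 17; Const 16 2; Sub 24 24 16]);
      Add 14 14 13])].

Definition exact_prog : prog :=
  block [:: exact_init;
    scan (block [:: Const 15 0; Const 21 0]) agent_step (block [:: Add 14 14 13]);
    exact_rooms;
    Add 14 14 23; Get 16 14; If 16 (Const 0 1) (Const 0 2)].

(** * Correctness of the exact program *)

Section Exact.
Variables (m n : nat) (P : profile m n) (a : 'I_m) (t : nat).
Let w := encode P a t.
Let B := radix m n.
Let L := B ^ m.

Definition tabled (s : memory) := [/\ loaded n a t s, s 11 = 32, s 13 = L,
  s 22 = budget m n t & forall b : 'I_m, s (b + 32) = B ^ b].

(* The cells from cur hold the characteristic function of X below L, those from
   cur + L the one of Y. *)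
Definition layered cur (X Y : nat -> Prop) (s : memory) :=
  [/\ tabled s, s 14 = cur, m + 32 <= cur,
      forall z, z < L -> s (cur + z) != 0 <-> X z
    & forall z, s (cur + L + z) != 0 <-> Y z].

Lemma tabled_upd s x v : 6 <= x -> x \notin [:: 11; 13; 22] -> (x < 32) || (m + 32 <= x) ->
  tabled s -> tabled (upd s x v).
Proof.
rewrite !inE !negb_or => hx /and3P[x11 x13 x22] hx' [[l0 l1 l2 l3 [l4 l5]] h11 h13 h22 h].
split; [split| | | |]; rewrite ?upd_ne //; try lia.
by move=> b; have bm := ltn_ord b; rewrite upd_ne //; lia.
Qed.

Lemma layered_upd cur X Y s x v : 6 <= x < 32 -> x \notin [:: 11; 13; 14; 22] ->
  layered cur X Y s -> layered cur X Y (upd s x v).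
Proof.
rewrite !inE !negb_or => hx /and4P[x11 x13 x14 x22] [T h14 mc hX hY].
split=> //; first by apply: tabled_upd T; rewrite ?inE; lia.
- by rewrite upd_ne //; lia.
- by move=> z zL; rewrite upd_ne; [exact: hX|lia].
- by move=> z; rewrite upd_ne; [exact: hY|lia].
Qed.

Lemma eq_layered cur (X X' Y Y' : nat -> Prop) s : (forall z, X z <-> X' z) ->
  (forall z, Y z <-> Y' z) -> layered cur X Y s -> layered cur X' Y' s.
Proof.
move=> eX eY [T h14 mc hX hY]; split=> // z; rewrite -?eX -?eY //; exact: hX.
Qed.

(** Layers are laid out consecutively in fresh memory. As [Y] has no member from [L] on, all cells
    past the new layer are still 0 and represent the empty set. *)
Lemma layered_next cur X (Y : nat -> Prop) s : (forall z, Y z -> z < L) ->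
  layered cur X Y s -> layered (cur + L) Y (fun=> False) (upd s 14 (cur + L)).
Proof.
move=> YL [T h14 mc hX hY]; split; upds => //; first exact: tabled_upd.
- by lia.
- by move=> z zL; upds.
- by move=> z; upds; rewrite -addnA hY; split=> // /YL; lia.
Qed.

Lemma layered_put cur (X Y : nat -> Prop) p s : layered cur X Y s ->
  layered cur X (fun z => Y z \/ z = p) (upd s (cur + L + p) 1).
Proof.
move=> [T h14 mc hX hY]; split; upds => //.
- by apply: tabled_upd T; rewrite ?inE; lia.
- by move=> z zL; upds; apply: hX.
- move=> z; have [->|zp] := eqVneq z p; first by upds; split=> // _; right.
  upds; rewrite hY; split; [by left | case=> // e].
  by rewrite e eqxx in zp.
Qed.

Lemma run_shift cur (X Y : nat -> Prop) d s :
  layered cur X Y s -> s 15 = d -> (forall z, X z -> z < L) ->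
  runs w shift (L * 10 + 5) s (fun s' =>
    layered cur X (fun z => Y z \/ exists2 x, X x & z = x + d) s' /\
    forall y, y < 32 -> y \notin [:: 18; 19; 20] -> s' y = s y).
Proof.
move=> H s15 XL; have [[[l0 l1 l2 l3 [l4 l5]] h11 h13 h22 h] h14 mc hX hY] := H.
eapply runs_leT.
  step. step.
  eapply runs_cons; last by move=> s1 h1; apply: runs_nil; exact: h1.
  apply: (runs_while (N := L) (T := 9) (I := fun k s' =>
    [/\ layered cur X (fun z => Y z \/ exists2 x, X x /\ x < k & z = x + d) s',
       s' 19 = cur + k, s' 20 = L - k & 
      forall y, y < 32 -> y \notin [:: 18; 19; 20] -> s' y = s y])).
  - split; upds; try lia; last by move=> y hy; rewrite !inE => hy'; upds.
    do 2 apply: layered_upd => //; apply: eq_layered H => // z; split; first by left.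
    by move=> [//|[x []]].
  - move=> k s1 kL [H1 e19 e20 e].
    have [[[g0 g1 g2 g3 [g4 g5]] g11 g13 g22 g] g14 _ gX gY] := H1.
    have g15 : s1 15 = d by rewrite e.
    split; first by lia.
    step.
    have [x0|x0] := eqVneq (s1 (cur + k)) 0.
      eapply runs_if_false; [by upds |].
      steps; apply: runs_last; split; upds; try lia.
        do 3 apply: layered_upd => //; apply: eq_layered H1 => // z.
        split=> -[Yz|[x [Xx xk] zE]]; [by left| | by left|].
          by right; exists x => //; split=> //; lia.
        right; exists x => //; split=> //; move: xk; rewrite ltnS leq_eqVlt => /orP[|//].
        by move=> /eqP xk; have := (gX _ kL).2; rewrite x0 -xk => /(_ Xx).
      by move=> y hy; rewrite !inE => hy'; upds; apply: e; rewrite ?inE.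
    eapply runs_if_true; [by upds | exact: x0 |].
    steps; apply: runs_last; split; upds; try lia; last first.
      by move=> y hy; rewrite !inE => hy'; upds; apply: e; rewrite ?inE.
    do 2 apply: layered_upd => //.
    have -> : cur + k + L + d = cur + L + (k + d) by lia.
    have {}x0 := (gX _ kL).1 x0.
    apply: (@eq_layered cur X X (fun z => (Y z \/ exists2 x, X x /\ x < k & z = x + d) \/
      z = k + d)); [by [] | | apply: layered_put]; last first.
      by do 3 apply: layered_upd => //.
      move=> z; split=> [[[Yz|[x [Xx xk] zE]]|->]|[Yz|[x [Xx xk] zE]]].
      + by left.
      + by right; exists x => //; split=> //; lia.
      + by right; exists k.
      + by left; left.
      + move: xk; rewrite ltnS leq_eqVlt => /orP[/eqP xk|xk]; first by right; rewrite zE xk.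
        by left; right; exists x.
  - move=> s1 [H1 e19 e20 e]; split; first by lia.
    split=> //; apply: eq_layered H1 => // z.
    split=> [[Yz|[x [Xx _] zE]]|[Yz|[x Xx zE]]]; try by left.
      by right; exists x.
    by right; exists x => //; split=> //; apply: XL.
by lia.
Qed.

Definition agents j s := exists cur, layered cur (reach P a t j m) (fun=> False) s.

(** The choices [c >= i] have already been merged into the next layer; cell 15 carries the code of
    candidate [i], updated incrementally as the row is read upwards. *)
Definition moving (j : 'I_n) i s := exists cur,
  [/\ layered cur (reach P a t j m) (fun z => exists x c,
        [/\ reach P a t j m x, i <= c <= pos P j a & z = x + code B (gain P a j c)]) s,
      s 15 = code B (gain P a j i) & s 21 = if i <= pos P j a then B ^ a else 0].

Lemma agents_stable j : stable (agents j).
Proof.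
by move=> s x v hx [cur h]; exists cur; apply: layered_upd h; rewrite ?inE; lia.
Qed.

Lemma moving_stable j i : stable (moving j i).
Proof.
move=> s x v hx [cur [h h15 h21]]; exists cur; split; upds => //.
by apply: layered_upd h; rewrite ?inE; lia.
Qed.

(** Moving the candidate position from [i.+1] to [i] adds the alternative at [i] to those beaten,
    and one exchange if [i] lies above [a]. Nothing changes when that alternative is [a]. *)
Lemma gain_step (j : 'I_n) (i : 'I_m) : code B (gain P a j i) = code B (gain P a j i.+1) +
  (if P j i == a then 0 else B ^ P j i + (if i <= pos P j a then B ^ a else 0)).
Proof.
have -> : (if P j i == a then 0 else B ^ P j i + (if i <= pos P j a then B ^ a else 0)) =
  code B (fun b => (if b == P j i then (P j i != a : nat) else 0) +
                   (if b == a then (P j i != a) && (i <= pos P j a) : nat else 0)).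
  rewrite codeD !code_single; case: eqP => //= _; rewrite mul1n.
  by case: leqP => _; rewrite ?mul1n.
rewrite -codeD; apply: eq_code => b; rewrite /gain.
rewrite -[P j i == a]eq_sym -!pos_at.
have [->|ba] := eqVneq b a; first by do ! case: (_ =P _) => ?; case: leqP; lia.
have : pos P j b != pos P j a by apply: contra ba => /eqP/pos_inj ->.
by do ! case: (_ =P _) => ?; lia.
Qed.

Hypothesis n0 : 0 < n.

Lemma run_agent_shift (j : 'I_n) (i : 'I_m) cur s :
  layered cur (reach P a t j m) (fun z => exists x c,
    [/\ reach P a t j m x, i < c <= pos P j a & z = x + code B (gain P a j c)]) s ->
  s 15 = code B (gain P a j i) -> s 21 = (if i <= pos P j a then B ^ a else 0) ->
  runs w (block [:: If 21 shift Skip]) (L * 10 + 8) s (fun s' => moving j i s' /\ control s s').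
Proof.
move=> H h15 h21; have [le_i|lt_i] := leqP i (pos P j a); rewrite ?le_i in h21.
  apply: (@runs_leT _ _ (L * 10 + 5 + 1).+1); last by lia.
  eapply runs_if_true; [exact: h21 | by rewrite -lt0n expn_gt0 |].
  eapply runs_cons; first by apply: run_shift H h15 _ => z; apply: reach_lt.
  move=> s1 [H1 e]; apply: runs_nil; split; last first.
    by move=> y hy; apply: e; rewrite ?inE; lia.
  exists cur; rewrite !e // h15 h21 le_i; split=> //; apply: eq_layered H1 => // z.
  split=> [[[x [c [Rx ic zE]]]|[x Rx zE]]|[x [c [Rx ic zE]]]].
  - by exists x, c; split=> //; lia.
  - by exists x, i; split=> //; lia.
  - have [ci|ci] := eqVneq c i; first by right; exists x; rewrite // zE ci.
    by left; exists x, c; split=> //; lia.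
rewrite leqNgt lt_i /= in h21.
apply: (@runs_leT _ _ 3); last by lia.
eapply runs_if_false => //; steps; apply: runs_last; split=> //.
exists cur; rewrite h15 h21 leqNgt lt_i; split=> //; apply: eq_layered H => // z.
by split=> -[x [c [Rx ic zE]]]; exists x, c; split=> //; lia.
Qed.

Lemma run_agent_step (j : 'I_n) (i : 'I_m) s : moving j i.+1 s -> s 10 = P j i ->
  runs w agent_step (L * 10 + 20) s (fun s' => moving j i s' /\ control s s').
Proof.
move=> [cur [H h15 h21]] h10.
have [[[l0 l1 l2 l3 [l4 l5]] h11 h13 h22 h] h14 mc hX hY] := H.
have hp := h (P j i).
have pai := pos_at P j i a; have gs := gain_step j i.
have keep s1 T : control s s1 ->
    runs w (block [:: If 21 shift Skip]) T s1 (fun s' => moving j i s' /\ control s1 s') ->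
    runs w (block [:: If 21 shift Skip]) T s1 (fun s' => moving j i s' /\ control s s').
  move=> c1 r; apply: runs_le r (leqnn _) _ => s' [M c2]; split=> // y hy.
  by rewrite c2 ?c1.
apply: (@runs_leT _ _ (L * 10 + 8).+4.+4.+2); last by lia.
do 5 step.
rewrite [a == _]eq_sym in pai.
have [e|ne] := eqVneq (P j i) a.
  rewrite e eqxx addn0 in gs pai; move/eqP: pai => pai.
  eapply runs_if_false; [by upds; rewrite e; lia |].
  step; apply: (@runs_leT _ _ (L * 10 + 8)); last by lia.
  apply: keep; first by move=> y hy; upds.
  apply: (@run_agent_shift _ _ cur); upds.
  - by do 6 apply: layered_upd => //.
  - by rewrite gs.
  - by rewrite pai leqnn e addn0.
eapply runs_if_true; [by upds | by move: ne; rewrite -val_eqE /=; lia |].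
step; step; step; apply: (@runs_leT _ _ (L * 10 + 8)); last by lia.
apply: keep; first by move=> y hy; upds.
have le_pos : (i < pos P j a) = (i <= pos P j a).
  by rewrite [RHS]leq_eqVlt eq_sym pai (negPf ne).
rewrite (negPf ne) -le_pos in gs.
apply: (@run_agent_shift _ _ cur); upds.
- by do 7 apply: layered_upd => //.
- by rewrite gs addnA.
- by rewrite h21 le_pos.
Qed.

Lemma run_agents s : loaded n a t s ->
  (forall s', loaded n a t s' -> (forall x, x < 6 \/ 10 < x -> s' x = s x) -> agents 0 s') ->
  runs w (scan (block [:: Const 15 0; Const 21 0]) agent_step (block [:: Add 14 14 13]))
    (n * (m * (L * 10 + 25) + 20) + 5) s (agents n).
Proof.
move=> l0 A0; apply: (@runs_leT _ _ (n * (3 + 3 + m * (L * 10 + 20 + 5) + 10) + 5)); last by nia.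
apply: (run_scan (J := agents) (I := moving)) => //.
- by move=> j s1 [cur [[]]].
- by move=> j i s1 [cur [[[]]]].
- exact: agents_stable.
- exact: moving_stable.
- move=> j s1 [cur h1]; steps; apply: runs_last; split; last by move=> y hy; upds.
  exists cur; split; upds.
  + do 2 apply: layered_upd => //; apply: eq_layered h1 => // z; split=> // -[x [c [_ hc _]]].
    by have := pos_lt P j a; lia.
  + rewrite /code big1 // => b _; rewrite /gain; have := pos_lt P j a; have := pos_lt P j b.
    by case: ifP => _; case: leqP => // *; rewrite (eqP (_ : _ - _ == 0)) //; lia.
  + by rewrite leqNgt pos_lt.
- exact: run_agent_step.
- move=> j s1 [cur [h1 _ _]].
  have [[[l0' l1 l2 l3 [l4 l5]] h11 h13 h22 h] h14 mc hX hY] := h1.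
  step; apply: runs_last; split; last by move=> y hy; upds.
  exists (cur + L); apply: eq_layered (layered_next _ h1) => // z.
    by rewrite reach_agent; split=> -[x [c [Rx hc zE]]]; exists x, c; split=> //; lia.
  move=> [x [c [Rx hc zE]]]; apply: (@reach_lt _ _ P a t j.+1 m) => //.
  by apply/reach_agent; exists x, c.
Qed.

Definition roomed i s := exists cur, [/\ layered cur (reach P a t n i) (fun=> False) s,
  s 9 = i & s 23 = \sum_(b < m | i <= b) target n a t b * B ^ b].

Lemma target_le b : target n a t b <= n * m.
Proof.
have m0 : 0 < m by apply: leq_ltn_trans (ltn_ord a).
by rewrite /target /budget; case: ifP => _; rewrite ?geq_minr ?leq_pmulr.
Qed.

Lemma room_le b : uphalf (room n a t b) <= n * m + 1.
Proof.
have m0 : 0 < m by apply: leq_ltn_trans (ltn_ord a).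
have nm : n <= n * m by rewrite leq_pmulr.
by rewrite /room /budget; case: ifP => _; have := uphalf_half n; have := odd_double_half n; lia.
Qed.

Lemma run_room (b : 'I_m) s : roomed b.+1 s ->
  runs w (block [:: Sub 9 9 5; Sub 16 9 3; Sub 17 3 9; Add 16 16 17;
      Add 17 9 11; Get 17 17;
      If 16 (block [:: Add 24 2 0; Add 25 2 0])
            (block [:: Add 24 22 22; Add 24 24 5; Add 25 22 0]);
      While 25 (block [:: Add 23 23 17; Sub 25 25 5]);
      Const 15 0;
      While 24 (block [:: shift; Add 15 15 17; Const 16 2; Sub 24 24 16]);
      Add 14 14 13]) (n * m * 4 + (n * m + 1) * (L * 10 + 15) + 30) s (roomed b).
Proof.
move=> [cur [H s9 s23]].
have [[[l0 l1 l2 l3 [l4 l5]] h11 h13 h22 h] h14 mc hX hY] := H.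
have hb := h b; have Lb := reach_lt (P := P) (a := a) (t := t) n0.
eapply runs_leT.
  step; rewrite (_ : b.+1 - 1 = b); last by lia.
  do 5 step.
  eapply (runs_cons (T1 := 6) (Q1 := fun s' => [/\
    layered cur (reach P a t n b.+1) (fun=> False) s',
    s' 9 = b /\ s' 17 = B ^ b, s' 23 = s 23, s' 24 = room n a t b & s' 25 = target n a t b])).
    apply: (@runs_leT _ _ 6) => //; apply: runs_if; rewrite 2?upd_ne // upd_eq => c16.
      have ba : b != a by rewrite -val_eqE /=; apply: contra c16 => /eqP ->; rewrite subnn.
      steps; apply: runs_last; rewrite /room /target (negPf ba); split; upds => //; try lia.
      by do 8 apply: layered_upd => //.
    have ba : b == a by rewrite -val_eqE /=; lia.
    steps; apply: runs_last; rewrite /room /target ba; split; upds => //; try lia.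
    by do 9 apply: layered_upd => //.
  move=> s1 [H1 [e9 e17] e23 e24 e25].
  eapply (runs_cons (Q1 := fun s' => [/\ layered cur (reach P a t n b.+1) (fun=> False) s',
    s' 9 = b /\ s' 17 = B ^ b, s' 23 = s 23 + target n a t b * B ^ b & s' 24 = room n a t b])).
    apply: (runs_while (N := target n a t b) (T := 3) (I := fun k s' =>
      [/\ layered cur (reach P a t n b.+1) (fun=> False) s', s' 9 = b /\ s' 17 = B ^ b,
        s' 23 = s 23 + k * B ^ b, s' 24 = room n a t b & s' 25 = target n a t b - k])).
    - by split=> //; lia.
    - move=> k s2 kg [H2 [f9 f17] f23 f24 f25].
      have [[[g0 g1 g2 g3 [g4 g5]] _ _ _ _] _ _ _ _] := H2.
      split; first by lia.
      steps; apply: runs_last; split; upds => //; try lia.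
      by do 2 apply: layered_upd => //.
    - move=> s2 [H2 f f23 f24 f25]; split; [by rewrite f25 subnn | by split].
  move=> s2 [H2 [f9 f17] f23 f24].
  step; eapply (runs_cons (Q1 := fun s' => [/\
      layered cur (reach P a t n b.+1) (fun z => exists x d,
        [/\ reach P a t n b.+1 x, d < uphalf (room n a t b) & z = x + d * B ^ b]) s',
      s' 9 = b /\ s' 17 = B ^ b & s' 23 = s 23 + target n a t b * B ^ b])).
    (* Cell 24 falls by 2 from [room n a t b], so there are [uphalf (room n a t b)] rounds; round
       [k] merges the states with slack [k] at digit [b]. *)
    apply: (runs_while (N := uphalf (room n a t b)) (T := L * 10 + 9) (I := fun k s' =>
      [/\ layered cur (reach P a t n b.+1) (fun z => exists x d,
         [/\ reach P a t n b.+1 x, d < k & z = x + d * B ^ b]) s',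
        s' 9 = b /\ s' 17 = B ^ b, s' 23 = s 23 + target n a t b * B ^ b,
        s' 24 = room n a t b - k.*2 & s' 15 = k * B ^ b])).
    - split; upds => //; try lia.
      by apply: layered_upd => //; apply: eq_layered H2 => // z; split=> // -[x [d []]].
    - move=> k s3 kr [H3 [g9 g17] g23 g24 g15].
      split; first by have := uphalf_half (room n a t b);
        have := odd_double_half (room n a t b); lia.
      apply: (@runs_leT _ _ (L * 10 + 5 + 4)); last by lia.
      eapply runs_cons; first by apply: run_shift H3 g15 _ => z; apply: Lb.
      move=> s4 [H4 e].
      have [[[k0 k1 k2 k3 [k4 k5]] _ _ _ _] _ _ _ _] := H4.
      have e4 y : y < 32 -> y \notin [:: 18; 19; 20] -> s4 y = s3 y by apply: e.
      have k15 := e4 15 isT isT; rewrite g15 in k15.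
      have k17 := e4 17 isT isT; rewrite g17 in k17.
      have k24 := e4 24 isT isT; rewrite g24 in k24.
      have k9 := e4 9 isT isT; rewrite g9 in k9.
      have k23 := e4 23 isT isT; rewrite g23 in k23.
      steps; apply: runs_last; split; upds => //; try lia.
      do 3 apply: layered_upd => //; apply: eq_layered H4 => // z.
      split=> [[[x [d [Rx dk zE]]]|[x Rx zE]]|[x [d [Rx dk zE]]]].
      + by exists x, d; split=> //; lia.
      + by exists x, k.
      + have [dk'|dk'] := eqVneq d k; first by right; exists x; rewrite // zE dk'.
        by left; exists x, d; split=> //; lia.
    - move=> s3 [H3 f f23' f24' _]; split; last by split.
      by have := uphalf_half (room n a t b); have := odd_double_half (room n a t b); lia.
  move=> s3 [H3 [g9 g17] g23].
  have [[_ _ k13 _ _] k14 _ _ _] := H3.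
  step; apply: runs_nil; exists (cur + L); split; upds => //; last first.
    by rewrite g23 s23 (sum_le_ord xpredT (fun b => target n a t b * B ^ b)).
  have Z z : (exists x d, [/\ reach P a t n b.+1 x, d < uphalf (room n a t b) & z = x + d * B ^ b])
      <-> reach P a t n b z by rewrite reach_room.
  apply: eq_layered (layered_next _ H3) => //.
  by move=> z /Z; apply: Lb.
have := target_le b; have := room_le b.
move: (target _ _ _ _) (uphalf _) (n * m) => x y N; nia.
Qed.

Lemma run_rooms s : agents n s ->
  runs w exact_rooms (m * (n * m * 4 + (n * m + 1) * (L * 10 + 15) + 31) + 5) s (roomed 0).
Proof.
move=> [cur H]; have [[[l0 l1 l2 l3 [l4 l5]] h11 h13 h22 h] h14 mc hX hY] := H.
eapply runs_leT.
  step. step.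
  eapply runs_cons; last by move=> s1 h1; apply: runs_nil; exact: h1.
  apply: (runs_while (N := m) (I := fun k => roomed (m - k))).
  - exists cur; split; upds; rewrite ?subn0 ?addn0 //.
      by do 2 apply: layered_upd => //.
    by rewrite big1 // => b; rewrite leqNgt ltn_ord.
  - move=> k s1 km R1; have bm : m - k.+1 < m by lia.
    have [b bE] : exists b : 'I_m, m - k.+1 = b by exists (Ordinal bm).
    have e : m - k = b.+1 by lia.
    rewrite e in R1; rewrite bE; split; last exact: run_room R1.
    by case: R1 => c [_ ->].
  - by move=> s1; rewrite subnn => R1; split=> //; case: R1 => c [_ ->].
by lia.
Qed.

Definition powered k (s : memory) := [/\ loaded n a t s,
  [/\ s 11 = 32, s 22 = budget m n t & s 12 = B], s 13 = B ^ k /\ s 14 = k + 32,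
  forall x, x < k -> s (x + 32) = B ^ x & forall y, k + 32 <= y -> s y = 0].

(** The machine has no multiplication: the next power is obtained by adding up [B] copies of
    [B ^ k]. *)
Lemma run_power k s : powered k s ->
  runs w (block [:: Put 14 13; Add 14 14 5; Const 16 0; Add 20 12 0;
      While 20 (block [:: Add 16 16 13; Sub 20 20 5]);
      Add 13 16 0; Sub 9 9 5]) (B * 4 + 10) s
    (fun s' => powered k.+1 s' /\ s' 9 = s 9 - 1).
Proof.
move=> [[l0 l1 l2 l3 [l4 l5]] [h11 h22 h12] [h13 h14] h h0].
eapply runs_leT.
  do 4 step.
  eapply (runs_cons (Q1 := fun s' => [/\ loaded n a t s',
    [/\ s' 11 = 32, s' 22 = budget m n t & s' 12 = B], s' 16 = B * B ^ k /\ s' 14 = k.+1 + 32,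
    s' 9 = s 9 & [/\ forall x, x < k.+1 -> s' (x + 32) = B ^ x &
      forall y, k.+1 + 32 <= y -> s' y = 0]])).
    apply: (runs_while (N := B) (T := 3) (I := fun i s' => [/\ loaded n a t s',
      [/\ s' 11 = 32, s' 22 = budget m n t & s' 12 = B],
      [/\ s' 13 = B ^ k, s' 16 = i * B ^ k & s' 14 = k.+1 + 32],
      s' 9 = s 9 /\ s' 20 = B - i & [/\ forall x, x < k.+1 -> s' (x + 32) = B ^ x &
      forall y, k.+1 + 32 <= y -> s' y = 0]])).
    - split; [split| split| split| split | split]; upds => //; try lia.
        move=> x hx; have [->|xk] := eqVneq x k; upds => //.
        by apply: h; lia.
      by move=> y hy; upds; apply: h0; lia.
    - move=> i s1 iB [[g0 g1 g2 g3 [g4 g5]] [g11 g22 g12] [g13 g16 g14] [g9 g20] [g gz]].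
      split; first by lia.
      steps; apply: runs_last.
      split; [split| split| split| split | split]; upds => //; try lia.
        by move=> x hx; upds; apply: g.
      by move=> y hy; upds; apply: gz.
    - move=> s1 [L1 c1 [_ e16 e14] [e9 e20] z1]; split; first by rewrite e20 subnn.
      by split.
  move=> s1 [[g0 g1 g2 g3 [g4 g5]] [g11 g22 g12] [g16 g14] g9 [g gz]].
  steps; apply: runs_nil; split; last by upds.
  split; [split| split| split| | ]; upds => //; try lia.
  - by rewrite expnS addn0.
  - by move=> x hx; upds; apply: g.
  - by move=> y hy; upds; apply: gz.
by lia.
Qed.

Lemma run_exact_init s : loaded n a t s -> s 12 = 0 -> (forall y, 32 <= y -> s y = 0) ->
  runs w exact_init (n * 4 + m * (B * 4 + 12) + 20) s (agents 0).
Proof.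
move=> [l0 l1 l2 l3 [l4 l5]] s12 sz; eapply runs_leT.
  step. step.
  eapply (runs_cons (Q1 := fun s' => [/\ loaded n a t s', s' 11 = 32, s' 12 = n * m &
    forall y, 32 <= y -> s' y = 0])).
    apply: (runs_while (N := n) (T := 3) (I := fun i s' => [/\ loaded n a t s', s' 11 = 32,
      s' 12 = i * m, s' 9 = n - i & forall y, 32 <= y -> s' y = 0])).
    - split; [split| | | |]; upds => //; try lia.
      by move=> y hy; upds; apply: sz.
    - move=> i s1 iN [[g0 g1 g2 g3 [g4 g5]] g11 g12 g9 gz]; split; first by lia.
      steps; apply: runs_last; split; [split| | | |]; upds => //; try lia.
      by move=> y hy; upds; apply: gz.
    - by move=> s1 [L1 e11 e12 e9 ez]; split; [rewrite e9 subnn | split].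
  move=> s1 [[g0 g1 g2 g3 [g4 g5]] g11 g12 gz].
  (* Cell 12 holds [n * m]. With truncated subtraction, [n * m - (n * m - t)] is the minimum stored
     in cell 22; doubling cell 12 and adding 1 then gives the radix. *)
  do 7 step.
  eapply (runs_cons (Q1 := powered m)).
    apply: (runs_while (N := m) (T := B * 4 + 10) (I := fun k s' => powered k s' /\ s' 9 = m - k)).
    - split; last by upds; lia.
      split; [split| split| split| |]; upds => //; try lia.
      + by rewrite /budget; lia.
      + by rewrite /B /radix; lia.
      + by move=> y hy; upds; apply: gz.
    - move=> k s2 km [H2 e9]; split; first by lia.
      by apply: runs_le (run_power H2) _ _ => // s3 [H3 f9]; split=> //; lia.
    - by move=> s2 [H2 e9]; split; [rewrite e9 subnn |].
  move=> s2 [[f0 f1 f2 f3 [f4 f5]] [f11 f22 f12] [f13 f14] f fz].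
  (* The last instruction marks 0 as the only member of the first layer, which starts right after
     the table of powers. *)
  step; apply: runs_nil; exists (m + 32).
  have L0 : 0 < L by rewrite expn_gt0.
  split; upds => //.
  - split; [split| | | |]; upds => //; try lia.
    by move=> b; have bm := ltn_ord b; upds; apply: f.
  - move=> z zL; rewrite reach0 //.
    have [->|z0] := eqVneq z 0; first by rewrite addn0 upd_eq.
    by upds; rewrite fz; [split=> // e; rewrite e in z0|lia].
  - by move=> z; upds; rewrite fz; [|lia].
by lia.
Qed.

Lemma run_exact_prog s : loaded n a t s -> s 12 = 0 -> (forall y, 32 <= y -> s y = 0) ->
  runs w exact_prog (n * 4 + m * (B * 4 + 12) + 20 + (n * (m * (L * 10 + 25) + 20) + 5) +
    (m * (n * m * 4 + (n * m + 1) * (L * 10 + 15) + 31) + 5) + 10) s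
    (fun s' => s' 0 = encode_answer (Some (dodgson_score_le P a t))).
Proof.
move=> Ls s12 sz; eapply runs_leT.
  eapply runs_cons; first exact: run_exact_init.
  move=> s1 A1; eapply runs_cons.
    apply: run_agents; first by case: A1 => cur [[]].
    move=> s2 L2 e; case: A1 => cur [[_ h11 h13 h22 h] h14 mc hX hY]; exists cur.
    split; [split=> //| | | |]; rewrite ?e ?h14 //; try lia.
    - by move=> b; rewrite e ?h //; lia.
    - by move=> z zL; rewrite e ?hX //; lia.
    - by move=> z; rewrite e ?hY //; lia.
  move=> s2 A2; eapply runs_cons; first exact: run_rooms A2.
  move=> s3 [cur [H3 _ e23]].
  have [[[l0 l1 l2 l3 [l4 l5]] h11 h13 h22 h] h14 mc hX hY] := H3.
  have {}e23 : s3 23 = code B (target n a t) by [].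
  have gL : code B (target n a t) < L.
    apply: code_lt => b; rewrite /B /radix; have := target_le b; lia.
  have XE := hX _ gL; rewrite reach_target // in XE.
  do 2 step; apply: (@runs_leT _ _ 4 4); last by [].
  case: (boolP (dodgson_score_le P a t)) XE => d XE.
    eapply runs_if_true; [by upds | by apply/XE |].
    by steps; apply: runs_last; upds.
  eapply runs_if_false.
    by upds; apply/eqP; apply/negPn/negP => /XE.
  by steps; apply: runs_last; upds.
by lia.
Qed.

End Exact.

(** * The hybrid algorithm *)

Definition hybrid (m0 : nat) : algorithm := fun m n P a t =>
  if m < m0 then Some (dodgson_score_le P a t) else greedy P a t.

(* Without agents the input has length O(log m), and no loop over the
   alternatives is affordable. *)
Definition hybrid_prog (m0 : nat) : prog :=
  block [:: load; Const 6 m0; Sub 6 6 1;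
    If 2 (If 6 exact_prog greedy_prog) (If 6 (Const 0 2) Skip)].

Lemma input_size_ge w : size w <= input_size w.
Proof. by rewrite -sum1_size; apply: leq_sum. Qed.

Definition exact_time m n := let B := radix m n in let L := B ^ m in
  n * 4 + m * (B * 4 + 12) + 20 + (n * (m * (L * 10 + 25) + 20) + 5) +
    (m * (n * m * 4 + (n * m + 1) * (L * 10 + 15) + 31) + 5) + 10.

Definition greedy_time m n := n * (m * 25 + 15) + n * 4 + m * 20 + 30.

Lemma run_hybrid m0 m n (P : profile m n) a t : 2 < m ->
  runs (encode P a t) (hybrid_prog m0)
    (20 + if n == 0 then 0 else if m < m0 then exact_time m n else greedy_time m n)
    (fun=> 0) (fun s => s 0 = encode_answer (hybrid m0 P a t)).
Proof.
move=> m3; set T := (T in 20 + T).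
apply: (@runs_leT _ _ (10 + (T + 2).+4.+2)); last by lia.
eapply runs_cons; first exact: run_load.
move=> s [[l0 l1 l2 l3 [l4 l5]] sz].
step. step.
rewrite /T; have [n0|n0] := posnP n.
  (* As [m >= 3], there is a rival, and without agents it cannot be beaten: the exact answer is NO,
     and the greedy one is a failure. *)
  have /card_gt0P[b ba] : 0 < #|predC1 a| by rewrite cardC1 card_ord; lia.
  have card0 (S : {set 'I_n}) : #|S| = 0.
    by apply/eqP; rewrite -leqn0 (leq_trans (max_card _)) // card_ord n0.
  eapply runs_if_false; [by upds; rewrite l2 |].
  rewrite /hybrid; have [c6|c6] := ltnP m m0.
    eapply runs_if_true; [by upds | by lia |].
    step; apply: runs_last; upds; case: (boolP (dodgson_score_le P a t)) => //.
    by move=> /dodgson_cuttable[c [_ _ /(_ b ba)]]; rewrite card0 n0.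
  eapply runs_if_false; [by upds; lia |].
  step; apply: runs_last; upds; rewrite /greedy; case: ifP => // /forall_inP/(_ b ba).
  by rewrite /near_over card0 ltn0.
eapply runs_if_true; [by upds | by lia |].
rewrite /hybrid; have [c6|c6] := ltnP m m0.
  eapply runs_if_true; [by upds | by lia |].
  apply: (@runs_leT _ _ (exact_time m n + 1)); last by lia.
  eapply runs_cons; last by move=> s1 h1; apply: runs_nil; exact: h1.
  apply: run_exact_prog; [by [] | by split; upds | by upds; apply: sz |].
  by move=> y hy; upds; apply: sz; lia.
eapply runs_if_false; [by upds; lia |].
apply: (@runs_leT _ _ (greedy_time m n + 1)); last by lia.
eapply runs_cons; last by move=> s1 h1; apply: runs_nil; exact: h1.
apply: run_greedy_prog; [by [] | by split; upds | by upds; apply: sz | by upds; apply: sz |].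
by move=> y hy; upds; apply: sz; lia.
Qed.

(** [Z = (2 * S) ^ m0] bounds [m], [n], [n * m], the radix and the layer length. The time expands
    into products of at most three of these, each at most [Z ^ 3], with coefficients adding up to
    less than 600. *)
Lemma exact_time_le m n S m0 : 0 < m < m0 -> 0 < n -> n * m < S ->
  exact_time m n <= 600 * 2 ^ (3 * m0) * S ^ (3 * m0).
Proof.
case/andP=> m1 mm0 n1 nS; rewrite -mulnA -expnMn mulnC [3 * m0]mulnC expnM.
set Z := (2 * S) ^ m0.
have SZ : 2 * S <= Z by rewrite -[X in X <= _]expn1 leq_pexp2l; lia.
have BZ : radix m n <= Z by rewrite /radix; lia.
have LZ : radix m n ^ m <= Z.
  apply: (@leq_trans ((2 * S) ^ m)); last by rewrite leq_pexp2l; lia.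
  by rewrite leq_exp2r // /radix; lia.
have mN : m <= n * m by rewrite leq_pmull.
have nN : n <= n * m by rewrite leq_pmulr.
rewrite /exact_time; move: (radix m n) (radix m n ^ m) BZ LZ => B L BZ LZ.
move: (n * m) mN nN nS {mm0} => N mN nN nS.
have mZ : m <= Z by lia.
have nZ : n <= Z by lia.
have NZ : N <= Z by lia.
have Z1 : 1 <= Z by lia.
have Z3 : Z ^ 3 = Z * Z * Z by rewrite !expnS expn0 muln1 mulnA.
have le2 x y : x <= Z -> y <= Z -> x * y <= Z ^ 3.
  by move=> xZ yZ; rewrite Z3 -[x * y]muln1; apply: leq_mul => //; apply: leq_mul.
have le3 x y z : x <= Z -> y <= Z -> z <= Z -> x * y * z <= Z ^ 3.
  by move=> xZ yZ zZ; rewrite Z3; do 2 apply: leq_mul => //.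
have := le2 m B mZ BZ; have := le3 n m L nZ mZ LZ; have := le2 n m nZ mZ.
have := le2 m N mZ NZ; have := le3 m N L mZ NZ LZ; have := le2 m L mZ LZ.
have := le2 m 1 mZ Z1; have := le2 n 1 nZ Z1; have := le2 1 1 Z1 Z1.
by move: (Z ^ 3) => Q; lia.
Qed.

Lemma hybrid_polynomial m0 : polynomial_time (hybrid m0).
Proof.
exists (hybrid_prog m0), (600 * 2 ^ (3 * m0) + 120), (3 * m0 + 1) => m n P a t m3.
have [s [k [e s0 kT]]] := run_hybrid m0 P a t m3.
exists s, k; split=> //; apply: leq_trans kT _.
have := input_size_ge (encode P a t); rewrite size_encode.
set S := input_size _ => leS.
have P2 : 0 < 2 ^ (3 * m0) by rewrite expn_gt0.
have PS : 0 < S ^ (3 * m0) by rewrite expn_gt0; lia.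
have [n0|n0] := posnP n; first by rewrite addn0; lia.
have mN : m <= n * m by rewrite leq_pmull.
have nN : n <= n * m by rewrite leq_pmulr //; lia.
rewrite addn1 expnS; case: ltnP => mm0.
  have : exact_time m n <= 600 * 2 ^ (3 * m0) * S ^ (3 * m0).
    by apply: exact_time_le => //; lia.
  move: (2 ^ _) (S ^ _) P2 PS => x y x0 y0.
  have : y <= S * y by rewrite leq_pmull //; lia.
  by move: (S * y) => z yz; nia.
(* Since [m] and [n] are at most [n * m], the greedy time is at most [64 * (n * m) + 30], while
   [n * m + 4 <= S]. *)
apply: (@leq_trans (20 + 100 * S)); first by rewrite leq_add2l /greedy_time; lia.
move: (2 ^ _) (S ^ _) P2 PS => x y x0 y0.
have : S <= S * y by rewrite leq_pmulr.
by move: (S * y) => z yz; nia.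
Qed.

Lemma hybrid_never_wrong m0 : never_wrong (hybrid m0).
Proof.
move=> m n P a t r _; rewrite /hybrid; case: ifP => _; first by case.
exact: greedy_correct.
Qed.

(** * Success probability *)

Definition near m (a b : 'I_m) (r : ranking m) : bool :=
  (r^-1%g a < r^-1%g b) || (r^-1%g a == (r^-1%g b).+1 :> nat).

Lemma perm_two_transitive (T : finType) (a b x y : T) :
  a != b -> x != y -> exists s : {perm T}, s a = x /\ s b = y.
Proof.
move=> ab xy; exists (tperm a x * tperm (tperm a x b) y)%g.
rewrite !permM tpermL tpermL; split=> //; apply: tpermD; last by rewrite eq_sym.
by rewrite -{2}(tpermL a x) (inj_eq perm_inj) eq_sym.
Qed.

(** Among [m.+1] positions there are [m * m.+1 / 2] pairs with [i < j] and [m] pairs with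
    [i = j.+1]. *)
Lemma sum_near_pairs m :
  2 * (\sum_(i < m.+1) \sum_(j < m.+1) ((i < j) || (i == j.+1 :> nat))) = m * (m + 3).
Proof.
rewrite exchange_big /=.
transitivity (2 * (\sum_(j < m.+1) (j + (j < m)))).
  congr (2 * _); apply: eq_bigr => j _.
  transitivity (\sum_(i < m.+1) ((i < j) + (i == j.+1 :> nat))).
    by apply: eq_bigr => i _; lia.
  rewrite big_split /=; congr (_ + _).
    rewrite -[LHS](big_mkord xpredT (fun i => (i < j : nat))).
    rewrite (big_cat_nat (n := j)) //=; last by apply: ltnW.
    rewrite (eq_big_nat _ _ (F2 := fun=> 1)); last by move=> i /andP[_ ->].
    rewrite sum_nat_const_nat big_nat big1 ?addn0; first by rewrite subn0 muln1.
    by move=> i /andP[h _]; rewrite ltnNge h.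
  have [jm|jm] := ltnP j m.
    rewrite (bigD1 (Ordinal (jm : j.+1 < m.+1))) //= eqxx big1 // => i.
    by rewrite -val_eqE /= => /negPf ->.
  by rewrite big1 // => i _; have := ltn_ord i; lia.
rewrite big_ord_recr /= ltnn (eq_bigr (fun j : 'I_m => j.+1)) => [|j _]; last first.
  by rewrite ltn_ord addn1.
have : 2 * (\sum_(j < m) j.+1) = m * m.+1; last by move: (\sum_(j < m) _) => S; rewrite addn0; nia.
by elim: m => [|m IH]; rewrite ?big_ord0 // big_ord_recr mulnDr IH /=; nia.
Qed.

(** By two-transitivity the count is the same for all ordered pairs of distinct alternatives. Summed
    over all pairs it is the number of permutations times the number of good pairs of positions,
    because each permutation merely reindexes the pairs. *)
Lemma card_near m (a b : 'I_m) : a != b ->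
  2 * m * #|[set r | near a b r]| = m`! * (m + 2).
Proof.
case: m a b => [[] //|m] a b ab.
pose lt (i j : 'I_m.+1) : bool := (i < j) || (i == j.+1 :> nat).
have N x y : x != y ->
    \sum_(s : {perm 'I_m.+1}) lt (s x) (s y) = #|[set r | near a b r]|.
  move=> xy; have [p [px py]] := perm_two_transitive ab xy.
  rewrite -sum1dep_card [RHS]big_mkcond [RHS](reindex_inj invg_inj) /=.
  rewrite (reindex_inj (mulgI p^-1%g)) /=; apply: eq_bigr => s _.
  by rewrite /lt /near invgK -px -py !permM !permK; case: ifP.
have T : \sum_(s : {perm 'I_m.+1}) \sum_x \sum_y lt (s x) (s y) =
    (m.+1)`! * \sum_(x < m.+1) \sum_(y < m.+1) lt x y.
  rewrite -[X in X * _](card_Sn m.+1) -sum_nat_const; apply: eq_bigr => s _.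
  rewrite [RHS](reindex_inj (@perm_inj _ s)); apply: eq_bigr => x _.
  by rewrite [RHS](reindex_inj (@perm_inj _ s)).
move: T; rewrite exchange_big /=.
rewrite (eq_bigr (fun=> m * #|[set r | near a b r]|)) => [|x _]; last first.
  rewrite exchange_big (bigD1 x) //= big1 ?add0n => [|s _]; last by rewrite /lt; lia.
  rewrite (eq_bigr (fun=> #|[set r | near a b r]|)) => [|y]; last by rewrite eq_sym; apply: N.
  by rewrite sum_nat_const cardC1 card_ord.
rewrite sum_nat_const card_ord.
have m0 : 0 < m by have := ltn_ord a; have := ltn_ord b; move: ab; rewrite -val_eqE /=; lia.
move=> T; apply/eqP; rewrite -(eqn_pmul2l m0); apply/eqP.
rewrite mulnCA -mulnA T mulnCA sum_near_pairs; ring.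
Qed.

Local Open Scope ring_scope.

(** * A single agent under impartial culture *)

Section Probability.
Variables (R : realType) (m : nat) (alpha : R).
Hypothesis alpha01 : 0 <= alpha <= 1.

Lemma IC_ge0 (r s : ranking m) : 0 <= IC alpha r s.
Proof.
by case/andP: alpha01 => a0 a1; rewrite /IC addr_ge0 ?mulr_ge0 ?invr_ge0 ?ler0n ?subr_ge0 //.
Qed.

Lemma IC_sum (r : ranking m) : \sum_s IC alpha r s = 1.
Proof.
rewrite big_split /= sumr_const -mulr_sumr (bigD1 r) //= eqxx big1 => [|s /negPf -> //].
rewrite card_Sn addr0 mulr1 -[_ / _ *+ _]mulr_natr divfK ?pnatr_eq0 ?gtn_eqF ?fact_gt0 //.
by rewrite addrC subrK.
Qed.

(** Only the uniform part of the mixture is counted, with frequency [(m + 2) / (2 * m)]; the atom at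
    [r] contributes a nonnegative amount. *)
Lemma IC_near (r : ranking m) (a b : 'I_m) : a != b ->
  alpha * (m%:R + 2) / (2 * m%:R) <= \sum_(s | near a b s) IC alpha r s.
Proof.
move=> ab; case/andP: alpha01 => a0 a1.
have mE := card_near ab; have m0 : (m%:R : R) != 0.
  by rewrite pnatr_eq0; case: m a {b ab mE} => [[]|].
have f0 : (m`!%:R : R) != 0 by rewrite pnatr_eq0 gtn_eqF ?fact_gt0.
apply: (@le_trans _ _ (\sum_(s | near a b s) alpha / m`!%:R)); last first.
  apply: ler_sum => s _; rewrite lerDl mulr_ge0 ?ler0n //.
  by rewrite subr_ge0.
rewrite sumr_const -cardsE -[_ / _ *+ _]mulr_natr.
move/(congr1 (fun x : nat => x%:R : R)): mE; rewrite !natrM natrD.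
move: (#|_|%:R : R) (m%:R : R) (m`!%:R : R) m0 f0 => N x f m0 f0 mE.
have -> : N = f * (x + 2) / (2 * x).
  by rewrite -mE; field.
rewrite [leRHS](_ : _ = alpha * (x + 2) / (2 * x)) //; field; exact/andP.
Qed.

End Probability.

(** * A Chernoff bound on the probability of a minority *)

Section Chernoff.
Variables (R : realType) (T : finType) (n : nat).
Variables (mu : 'I_n -> T -> R) (X : pred T) (e : R).
Hypothesis mu_ge0 : forall j x, 0 <= mu j x.
Hypothesis mu_sum : forall j, \sum_x mu j x = 1.
Hypothesis e_gt0 : 0 < e.
Hypothesis mu_X : forall j, 2^-1 + e <= \sum_(x | X x) mu j x.

Lemma minority_prob :
  \sum_(f : {ffun 'I_n -> T} | (2 * #|[set j | X (f j)]| <= n)%N)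
     \prod_j mu j (f j) <= expR (- (n%:R * e ^+ 2)).
Proof.
(* E[u ^ (n - 2k)] with k the number of j in X bounds the probability of 2k <= n. *)
pose u : R := 1 + e; have u1 : 1 < u by rewrite ltrDl.
have u0 : 0 < u by apply: lt_trans u1.
pose wt x : R := if X x then u^-1 else u.
have wt0 x : 0 < wt x by rewrite /wt; case: ifP; rewrite ?invr_gt0.
apply: (@le_trans _ _ (\sum_(f : {ffun 'I_n -> T}) \prod_j (mu j (f j) * wt (f j)))).
  rewrite big_mkcond /=; apply: ler_sum => f _; case: ifP => [h|_]; last first.
    by apply: prodr_ge0 => j _; rewrite mulr_ge0 // ltW.
  rewrite big_split /= ler_peMr ?prodr_ge0 //.
  rewrite (bigID (fun j => X (f j))) /=.
  rewrite (eq_bigr (fun=> u^-1)) => [|j]; last by rewrite /wt => ->.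
  rewrite [X in _ * X](eq_bigr (fun=> u)) => [|j]; last by rewrite /wt => /negPf ->.
  rewrite !prodr_const; move: h; rewrite cardsE.
  have := cardC (fun j => X (f j)); rewrite card_ord.
  rewrite [X in (_ + X)%N](@eq_card _ _ (fun j => ~~ X (f j))) //.
  set k := (X in (X + _)%N); set l := (X in (_ + X)%N) => klE kl'.
  have {klE kl'}kl : (k <= l)%N by lia.
  by rewrite exprVn mulrC -expfB_cond ?gt_eqF //= exprn_ege1 // ltW.
(* Independence: the sum over all families of outcomes factors into the expectations of [wt] for the
   single agents. *)
rewrite -(bigA_distr_bigA (fun j x => mu j x * wt x)) /=.
apply: (@le_trans _ _ (\prod_(j < n) expR (- e ^+ 2))).
  apply: ler_prod => j _; apply/andP; split.
    by apply: sumr_ge0 => x _; rewrite mulr_ge0 // ltW.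
  apply: le_trans (expR_ge1Dx _); set p := \sum_(x | X x) mu j x.
  (* The expectation of [wt] is affine and decreasing in the mass [p] of [X], so [p] can be replaced
     by its lower bound [1/2 + e]. The resulting value falls short of [1 - e ^+ 2] by
     [e ^+ 2 / (2 * u)]. *)
  have -> : \sum_x mu j x * wt x = u - (u - u^-1) * p.
    transitivity (\sum_x (mu j x * u - (u - u^-1) * (if X x then mu j x else 0))).
      by apply: eq_bigr => x _; rewrite /wt; case: ifP => _; ring.
    by rewrite sumrB -mulr_suml mu_sum mul1r -mulr_sumr -big_mkcond.
  have : (u - u^-1) * (2^-1 + e) <= (u - u^-1) * p.
    apply: ler_wpM2l; last exact: mu_X.
    by rewrite subr_ge0 (le_trans _ (ltW u1)) // invf_le1 // ltW //.
  suff : u - (u - u^-1) * (2^-1 + e) <= 1 - e ^+ 2 by lra.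
  rewrite -subr_ge0.
  have -> : 1 - e ^+ 2 - (u - (u - u^-1) * (2^-1 + e)) = e ^+ 2 / (2 * u).
    by rewrite /u; field; rewrite -/u gt_eqF.
  by rewrite divr_ge0 ?mulr_ge0 ?sqr_ge0 // ltW.
by rewrite prodr_const card_ord -[- (n%:R * _)]mulrN expRM_natl.
Qed.

End Chernoff.

(** * The union bound over the rivals *)

Section Success.
Variables (R : realType) (m n : nat) (alpha : R) (theta : 'I_n -> ranking m).
Hypothesis alpha01 : 0 <= alpha <= 1.
Let mu j := IC alpha (theta j).

Lemma profile_probT : profile_prob mu xpredT = 1.
Proof.
rewrite /profile_prob -(bigA_distr_bigA mu) big1 // => j _; exact: IC_sum.
Qed.

Lemma greedy_succeeds (a : 'I_m) t : (3 <= m)%N -> 1 - m%:R^-1 <= alpha ->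
  1 - 2 * (m%:R - 1) * expR (- (n%:R / (72 * m%:R ^+ 2))) <=
  profile_prob mu (fun P => greedy P a t == Some (dodgson_score_le P a t)).
Proof.
move=> m3 alpha_m; set x := expR _.
pose F b (P : profile m n) := (2 * near_over P a b <= n)%N.
have M3 : 3 <= m%:R :> R by rewrite (ler_nat _ 3).
have M0 : 0 < m%:R :> R by lra.
have FP b : b != a -> profile_prob mu (F b) <= x.
  move=> ba; rewrite eq_sym in ba.
  apply: le_trans (@minority_prob R _ n mu (near a b) (6 * m%:R)^-1 _ _ _ _) _.
  - by move=> j r; apply: IC_ge0.
  - by move=> j; apply: IC_sum.
  - by rewrite invr_gt0; lra.
  - move=> j; apply: le_trans (IC_near alpha01 (theta j) ba).
    apply: (@le_trans _ _ ((1 - m%:R^-1) * (m%:R + 2) / (2 * m%:R))); last first.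
      by rewrite ler_wpM2r ?invr_ge0 ?ler_wpM2r //; lra.
    (* At [alpha = 1 - 1/m] the margin above [1/2 + 1/(6 m)] is [(m - 3) / (3 m^2)], nonnegative
       because [m >= 3]. *)
    rewrite -subr_ge0.
    have -> : (1 - m%:R^-1) * (m%:R + 2) / (2 * m%:R) - (2^-1 + (6 * m%:R)^-1) =
       (m%:R - 3) / (3 * m%:R ^+ 2) :> R by field; rewrite gt_eqF.
    by rewrite divr_ge0 ?mulr_ge0 ?sqr_ge0 ?subr_ge0.
  (* With [e = 1/(6 m)] the Chernoff exponent is [n / (36 m^2)], which is at least
     [n / (72 m^2)]. *)
  - rewrite /x ler_expR lerN2 exprVn exprMn ler_wpM2l ?ler0n //.
    rewrite lef_pV2 ?posrE ?mulr_gt0 ?exprn_gt0 //.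
    by rewrite ler_wpM2r ?sqr_ge0 //; lra.
set E := fun P => _.
have EF P : ~~ E P -> exists2 b, b != a & F b P.
  rewrite /E /F; case G: (greedy P a t) => [r|].
    by rewrite (greedy_correct G) eqxx.
  move: G; rewrite /greedy; case: ifP => // /negbT.
  rewrite negb_forall_in => /exists_inP[b ba]; rewrite -leqNgt => ? _ _; by exists b.
(* Every profile outside [E] lies in some [F b], so [E] and these events together carry mass at
   least 1. This yields [1 - (m - 1) x], which implies the bound as [(m - 1) x] is nonnegative. *)
have : 1 <= profile_prob mu E + \sum_(b | b != a) profile_prob mu (F b).
  rewrite -profile_probT /profile_prob (exchange_big_dep xpredT) //=.
  rewrite [X in _ <= X + _]big_mkcond -big_split /=.
  apply: ler_sum => P _.
  have p0 : 0 <= \prod_(j < n) mu j (P j) by apply: prodr_ge0 => j _; apply: IC_ge0.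
  case: ifP => [_|/negbT/EF[b ba Fb]].
    by rewrite lerDl sumr_ge0.
  by rewrite add0r (bigD1 b) /= ?ba //= lerDl sumr_ge0.
have : \sum_(b | b != a) profile_prob mu (F b) <= x * (m%:R - 1).
  apply: (@le_trans _ _ (\sum_(b | b != a) x)).
    by apply: ler_sum => b; apply: FP.
  rewrite sumr_const cardC1 card_ord -[x *+ _]mulr_natr ler_wpM2l ?expR_ge0 //.
  by rewrite -subn1 natrB //; lia.
have : 0 <= x * (m%:R - 1) by rewrite mulr_ge0 ?expR_ge0 //; lra.
nra.
Qed.

End Success.

Theorem theorem5 (R : realType) (alpha : nat -> R)
  (alpha01 : forall m : nat, (3 <= m)%N -> 0 <= alpha m <= 1)
  (alpha_large : exists m0 : nat, forall m : nat, (3 <= m)%N -> (m0 <= m)%N ->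
     1 - m%:R^-1 <= alpha m <= 1) :
  exists A : algorithm,
    [/\ polynomial_time A,
        never_wrong A
      & succeeds_with_prob alpha A (fun m n : nat =>
          1 - 2 * (m%:R - 1) * expR (- (n%:R / (72 * m%:R ^+ 2))))].
Proof.
have [m0 large] := alpha_large.
exists (hybrid m0); split; first exact: hybrid_polynomial.
  exact: hybrid_never_wrong.
move=> m n theta a t m3; rewrite /hybrid; case: ltnP => mm0; last first.
  by apply: greedy_succeeds; [exact: alpha01 | | case/andP: (large m m3 mm0)].
(* Below [m0] the answer is always exact, so the success probability is 1 and only the bound being
   at most 1 remains. *)
have -> : profile_prob (fun j => IC (alpha m) (theta j))
    (fun P => Some (dodgson_score_le P a t) == Some (dodgson_score_le P a t)) = 1.
  rewrite -(profile_probT (alpha m) theta); apply: eq_bigl => P.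
  by rewrite eqxx.
rewrite gerBl mulr_ge0 ?expR_ge0 // mulr_ge0 // subr_ge0 ler1n; lia.
Qed.
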